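(* Let $\mathcal H$ and $(\mathcal G_i)_{1\leq i\leq m}$ be real Hilbert spaces, where $m$ is a strictly positive integer. Let $z\in\mathcal H$, let $A\colon\mathcal H\to2^{\mathcal H}$ be maximally monotone, let $\mu\in\left]0,+\infty\right[$, and let $C\colon\mathcal H\to\mathcal H$ be $\mu$-cocoercive. For every $i\in\{1,\ldots,m\}$, let $r_i\in\mathcal G_i$, let $B_i\colon\mathcal G_i\to2^{\mathcal G_i}$ be maximally monotone, let $\nu_i\in\left]0,+\infty\right[$, let $D_i\colon\mathcal G_i\to2^{\mathcal G_i}$ be maximally monotone and $\nu_i$-strongly monotone, and let $L_i\colon\mathcal H\to\mathcal G_i$ be a nonzero bounded linear operator. Consider the primal inclusion $$\text{(P)}\quad\text{find }\overline x\in\mathcal H\text{ such that }z\in A\overline x+\sum_{i=1}^mL_i^*\big((B_i\,\square\,D_i)(L_i\overline x-r_i)\big)+C\overline x,$$ and the dual inclusion $$\text{(D)}\quad\text{find }\overline{v_1}\in\mathcal G_1,\ldots,\overline{v_m}\in\mathcal G_m\text{ such that }(\exists x\in\mathcal H)\quad\begin{cases}z-\sum_{i=1}^mL_i^*\overline{v_i}\in Ax+Cx\\(\forall i\in\{1,\ldots,m\})\quad\overline{v_i}\in(B_i\,\square\,D_i)(L_ix-r_i).\end{cases}$$ Suppose that $$z\in\operatorname{ran}\Big(A+\sum_{i=1}^mL_i^*\big((B_i\,\square\,D_i)(L_i\cdot-r_i)\big)+C\Big),$$ and set $\beta=\min\{\mu,\nu_1,\ldots,\nu_m\}$. Let $\varepsilon\in\left]0,\min\{1,\beta\}\right[$,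 let $\alpha\in\left]0,+\infty\right[$, let $(\lambda_n)_{n\in\mathbb N}$ be a sequence in $[\varepsilon,1]$, let $x_0\in\mathcal H$, let $(a_n)_{n\in\mathbb N}$ and $(c_n)_{n\in\mathbb N}$ be absolutely summable sequences in $\mathcal H$, and let $(U_n)_{n\in\mathbb N}$ be a sequence in $\mathcal P_\alpha(\mathcal H)$ such that $(\forall n\in\mathbb N)$ $U_{n+1}\succcurlyeq U_n$. For every $i\in\{1,\ldots,m\}$, let $v_{i,0}\in\mathcal G_i$, let $(b_{i,n})_{n\in\mathbb N}$ and $(d_{i,n})_{n\in\mathbb N}$ be absolutely summable sequences in $\mathcal G_i$, and let $(U_{i,n})_{n\in\mathbb N}$ be a sequence in $\mathcal P_\alpha(\mathcal G_i)$ such that $(\forall n\in\mathbb N)$ $U_{i,n+1}\succcurlyeq U_{i,n}$. For every $n\in\mathbb N$, set $$\delta_n=\Bigg(\sqrt{\sum_{i=1}^m\big\|\sqrt{U_{i,n}}\,L_i\sqrt{U_n}\big\|^2}\Bigg)^{-1}-1,$$ and suppose that $$\zeta_n=\frac{\delta_n}{(1+\delta_n)\max\{\|U_n\|,\|U_{1,n}\|,\ldots,\|U_{m,n}\|\}}\geq\frac1{2\beta-\varepsilon}.$$ For every $n\in\mathbb N$, set $$p_n=J_{U_nA}\Big(x_n-U_n\Big(\sum_{i=1}^mL_i^*v_{i,n}+Cx_n+c_n-z\Big)\Big)+a_n,\qquad y_n=2p_n-x_n,\qquad x_{n+1}=x_n+\lambda_n(p_n-x_n),$$ and, for $i=1,\ldots,m$,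 $$q_{i,n}=J_{U_{i,n}B_i^{-1}}\Big(v_{i,n}+U_{i,n}\big(L_iy_n-D_i^{-1}v_{i,n}-d_{i,n}-r_i\big)\Big)+b_{i,n},\qquad v_{i,n+1}=v_{i,n}+\lambda_n(q_{i,n}-v_{i,n}).$$ Then the following hold for some solution $\overline x$ to (P) and some solution $(\overline{v_1},\ldots,\overline{v_m})$ to (D). (i) $x_n\rightharpoonup\overline x$ (weak convergence). (ii) $(\forall i\in\{1,\ldots,m\})$ $v_{i,n}\rightharpoonup\overline{v_i}$ (weak convergence). (iii) Suppose that $C$ is demiregular at $\overline x$. Then $x_n\to\overline x$ (strong convergence). (iv) Suppose that, for some $j\in\{1,\ldots,m\}$, $D_j^{-1}$ is demiregular at $\overline{v_j}$. Then $v_{j,n}\to\overline{v_j}$ (strong convergence).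
   Context: For a real Hilbert space $\mathcal H$ with scalar product $\langle\cdot\mid\cdot\rangle$ and norm $\|\cdot\|$: - For bounded self-adjoint linear operators $U,V$ on $\mathcal H$, $U\succcurlyeq V$ means $\langle Ux\mid x\rangle\geq\langle Vx\mid x\rangle$ for every $x\in\mathcal H$. For $\alpha\in[0,+\infty[$, $\mathcal P_\alpha(\mathcal H)$ is the set of bounded self-adjoint linear operators $U$ on $\mathcal H$ such that $U\succcurlyeq\alpha\,\mathrm{Id}$; $\sqrt U$ denotes the (positive self-adjoint) square root of $U\in\mathcal P_\alpha(\mathcal H)$. - A sequence $(a_n)$ in $\mathcal H$ is absolutely summable if $\sum_n\|a_n\|<+\infty$. $L^*$ denotes the adjoint of a bounded linear operator $L$. - A set-valued operator $A\colon\mathcal H\to2^{\mathcal H}$ has graph $\operatorname{gra}A=\{(x,u)\mid u\in Ax\}$, domain $\operatorname{dom}A=\{x\mid Ax\neq\varnothing\}$, range $\operatorname{ran}A=\{u\mid(\exists x)\ u\in Ax\}$, and inverse $A^{-1}\colon u\mapsto\{x\mid u\in Ax\}$. It is monotone if $\langle x-y\mid u-v\rangle\geq0$ for all $(x,u),(y,v)\in\operatorname{gra}A$; maximally monotone if moreover its graph is not properly contained in the graph of another monotone operator; and $\nu$-strongly monotone if $A-\nu\,\mathrm{Id}$ is monotone. Sums and compositions with linear operators are taken pointwise on sets; e.g. $UA\colon x\mapsto\{Uu\mid u\in Ax\}$. - $C\colon\mathcal H\to\mathcal H$ is $\mu$-cocoercive if $\langle x-y\mid Cx-Cy\rangle\geq\mu\|Cx-Cy\|^2$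 for all $x,y\in\mathcal H$. - The resolvent of $A$ is $J_A=(\mathrm{Id}+A)^{-1}$. The parallel sum of $B$ and $D$ is $B\,\square\,D=(B^{-1}+D^{-1})^{-1}$. The operators $D_i^{-1}$ and the resolvents appearing in the algorithm are single-valued and defined everywhere, so they are identified with functions. - An operator $A\colon\mathcal H\to2^{\mathcal H}$ is demiregular at $x\in\operatorname{dom}A$ if, for every sequence $((x_n,u_n))_{n\in\mathbb N}$ in $\operatorname{gra}A$ and every $u\in Ax$ such that $x_n\rightharpoonup x$ (weakly) and $u_n\to u$ (strongly), we have $x_n\to x$ (strongly). *)

(* Defs.v *)
From HB Require Import structures.
From mathcomp Require Import all_boot all_order all_algebra.
From mathcomp Require Import all_classical all_reals all_analysis.

Set Implicit Arguments.
Unset Strict Implicit.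
Unset Printing Implicit Defensive.

Import Order.TTheory GRing.Theory Num.Theory.
Import numFieldNormedType.Exports.

Local Open Scope classical_set_scope.
Local Open Scope ring_scope.

(* A real Hilbert space is a complete normed module whose norm is the one
   induced by a symmetric positive definite bilinear form. *)
HB.mixin Record CompleteNormedModule_isHilbert (R : realType) H
    & CompleteNormedModule R H := {
  inner : {dot H for @idfun R} ;
  inner_norm : forall x : H, inner x x = `|x| ^+ 2
}.

#[short(type="hilbertType")]
HB.structure Definition Hilbert (R : realType) :=
  {H of CompleteNormedModule_isHilbert R H & CompleteNormedModule R H}.

Notation "'< x , y >" := (inner x y)
  (at level 0, x at level 69, y at level 69, format "''<' x ,  y >")
  : ring_scope.

Section Sequences.
Context {R : realType} {H : hilbertType R}.
Implicit Types (u : nat -> H) (x : H).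

(* By Riesz representation, testing against the functionals '< . , y > is
   testing against the whole topological dual. *)
Definition weak_cvg u x : Prop :=
  forall y : H, (fun n => '<u n, y>) @ \oo --> '<x, y>.

Definition absolutely_summable u : Prop := cvgn [normed series u].

End Sequences.

Section BoundedLinear.
Context {R : realType}.
Implicit Types H G : hilbertType R.

Definition bounded_linear H G (L : H -> G) : Prop :=
  linear L /\ exists M : R, forall x, `|L x| <= M * `|x|.

Definition opnorm H G (L : H -> G) : R :=
  sup [set `|L x| | x in [set x : H | `|x| <= 1]].

Definition is_adjoint H G (L : H -> G) (M : G -> H) : Prop :=
  forall x y, '<L x, y> = '<x, M y>.

(* When L is bounded and linear, exactly one M satisfies is_adjoint L M. *)
Definition adjoint H G (L : H -> G) : G -> H :=
  xget (fun=> 0) [set M | is_adjoint L M].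

Definition self_adjoint H (U : H -> H) : Prop := is_adjoint U U.

(* loewner_ge U V is "U >= V" for the Loewner order. *)
Definition loewner_ge H (U V : H -> H) : Prop :=
  forall x, '<V x, x> <= '<U x, x>.

(* The set P_alpha(H). *)
Definition posop H (alpha : R) : set (H -> H) :=
  [set U | [/\ bounded_linear U, self_adjoint U
             & loewner_ge U (fun x => alpha *: x)]].

(* Every U in P_0(H) has exactly one square root in P_0(H). *)
Definition sqrtop H (U : H -> H) : H -> H :=
  xget (fun=> 0) [set S | posop 0 S /\ S \o S = U].

End BoundedLinear.

(* A set-valued operator from H to G is a function H -> set G. *)
Section SetValued.
Context {R : realType}.
Implicit Types H G : hilbertType R.

Definition graph H G (A : H -> set G) : set (H * G) := [set xu | A xu.1 xu.2].

Definition dom H G (A : H -> set G) : set H := [set x | A x !=set0].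

Definition ran H G (A : H -> set G) : set G := [set u | exists x, A x u].

Definition opinv H G (A : H -> set G) : G -> set H := fun u => [set x | A x u].

Definition single H G (f : H -> G) : H -> set G := fun x => [set f x].

(* The function identified with a set-valued operator whose values are all
   singletons. *)
Definition fun_of H G (A : H -> set G) : H -> G := fun x => xget 0 (A x).

Definition setadd H (S T : set H) : set H := [set s + t | s in S & t in T].

Definition opadd H G (A B : H -> set G) : H -> set G :=
  fun x => setadd (A x) (B x).

Definition opcomp H G K (U : G -> K) (A : H -> set G) : H -> set K :=
  fun x => U @` A x.

Definition monotone H (A : H -> set H) : Prop :=
  forall x u y v, A x u -> A y v -> 0 <= '<x - y, u - v>.

Definition maximally_monotone H (A : H -> set H) : Prop :=
  monotone A /\ forall B : H -> set H, monotone B -> ~ (graph A `<` graph B).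

Definition strongly_monotone H (nu : R) (A : H -> set H) : Prop :=
  monotone (opadd A (single (fun x => - (nu *: x)))).

Definition cocoercive H (mu : R) (C : H -> H) : Prop :=
  forall x y, mu * `|C x - C y| ^+ 2 <= '<x - y, C x - C y>.

Definition resolvent H (A : H -> set H) : H -> set H :=
  opinv (opadd (single id) A).

Definition parallel_sum H (B D : H -> set H) : H -> set H :=
  opinv (opadd (opinv B) (opinv D)).

Definition demiregular H (A : H -> set H) (x : H) : Prop :=
  dom A x /\
  forall (xs us : nat -> H) (u : H),
    (forall n, A (xs n) (us n)) -> A x u ->
    weak_cvg xs x -> us @ \oo --> u -> xs @ \oo --> x.

End SetValued.

Section PrimalDual.
Context {R : realType} {H : hilbertType R} {m : nat} {G : 'I_m -> hilbertType R}.

(* A + \sum_i L_i^* ((B_i [] D_i) (L_i . - r_i)) + C, where the sum over i is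
   the iterated Minkowski sum. *)
Definition primal_op (A : H -> set H) (C : H -> H) (r : forall i, G i)
    (B D : forall i, G i -> set (G i)) (L : forall i, H -> G i) : H -> set H :=
  fun x =>
    setadd (setadd (A x)
      (\big[@setadd R H/[set 0]]_(i < m)
         (adjoint (L i) @` parallel_sum (B i) (D i) (L i x - r i))))
      [set C x].

Definition primal_solution (z : H) (A : H -> set H) (C : H -> H)
    (r : forall i, G i) (B D : forall i, G i -> set (G i))
    (L : forall i, H -> G i) (x : H) : Prop :=
  primal_op A C r B D L x z.

Definition dual_solution (z : H) (A : H -> set H) (C : H -> H)
    (r : forall i, G i) (B D : forall i, G i -> set (G i))
    (L : forall i, H -> G i) (v : forall i, G i) : Prop :=
  exists x : H,
    setadd (A x) [set C x] (z - \sum_(i < m) adjoint (L i) (v i)) /\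
    forall i, parallel_sum (B i) (D i) (L i x - r i) (v i).

End PrimalDual.

(* Main.v *)
Require Import Defs.
From HB Require Import structures.
From mathcomp Require Import all_boot all_order all_algebra.
From mathcomp Require Import all_classical all_reals all_analysis.
From mathcomp Require Import ring lra.

Set Implicit Arguments.
Unset Strict Implicit.
Unset Printing Implicit Defensive.

Import Order.TTheory GRing.Theory Num.Theory.
Import numFieldNormedType.Exports.

Local Open Scope classical_set_scope.
Local Open Scope ring_scope.

(** Collect x and the v_i into one vector k of the Hilbert direct sum K of H and
    of the G_i. The primal-dual inclusion becomes the single inclusion of 0 in
    M k + N k, where
      M k = (A x - z + sum_i adjoint L_i v_i, B_i^-1 v_i + r_i - L_i x)
    is maximally monotone, being a product of maximally monotone operators plus
    a bounded skew map ([block_op_maximally_monotone]), and where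
      N k = (C x, D_i^-1 v_i)
    is beta-cocoercive ([block_coco_cocoercive]). Up to errors, one step of the
    algorithm sends k to the k+ such that W (k - k+) - N k is in M k+, for
      W k = (U^-1 x - sum_i adjoint L_i v_i, V_i^-1 v_i - L_i x)
    ([exact_stepP]): the off-diagonal part of W is what allows q_i to be computed
    after p, from 2 p - x. So the algorithm is a forward-backward iteration in K
    whose metric W = W_n varies. The metrics decrease because U_n and V_(i,n)
    increase, and the lower bound on zeta_n says that W_n is at least
    1 / (2 beta - eps) times the identity ([block_metric_ge],
    [step_size_bounds]). The error sequences move each step by a summable amount
    ([primal_step_error], [dual_step_error]).

    It remains to prove that such iterations converge
    ([forward_backward_weak_cvg]). If w is a zero of M + N, monotonicity and
    cocoercivity show that one exact step decreases the squared W_n-distance to w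
    by at least c (|k - k+|^2 + |N k - N w|^2); here c > 0 precisely because W_n
    is bounded below by more than 1 / (2 beta)
    ([forward_backward_decrease]). As the metrics decrease and the errors are
    summable, the W_n-distance from k_n to each zero converges, k_n - k_n+ tends to
    0 and N k_n tends strongly to N w ([forward_backward_fejer]). Weak limits are
    taken along ultrafilters, where they always exist for bounded sequences
    ([weak_ultra_limit]); each of them is a zero, by maximality of M
    ([forward_backward_demiclosed]). They all coincide, by the argument of Opial:
    the W_n converge pointwise ([decreasing_operators_cvg]), so the convergence
    of the distances to two weak limits forces their difference to vanish. Hence
    k_n converges weakly. Finally, the strong convergence of
    N k_n = (C x_n, D_i^-1 v_(i,n)) is what demiregularity turns into strong
    convergence of x_n or of v_(j,n).

    The functional analysis behind this rests on one existence result, for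
    minimizers of strongly convex closed functions ([argmin_exists]). It yields
    the representation theorem of Riesz, hence adjoints, and the theorem of
    Minty, by minimizing the Fitzpatrick function of the operator plus half the
    squared norm ([minty_zero]). Minty's theorem makes the resolvents
    and the D_i^-1 everywhere defined. *)

(** * Real inequalities *)

Section RealLemmas.
Variable R : realType.
Implicit Types a b c : R.

(** The elementary source of every Cauchy-Schwarz inequality below. *)
Lemma discriminant_le a b c :
  (forall t, 0 <= a + 2 * t * b + t ^+ 2 * c) -> b ^+ 2 <= a * c.
Proof.
move=> h; have [c0|c0] := eqVneq c 0.
  have [->|b0] := eqVneq b 0; first by rewrite c0 mulr0 expr0n.
  have := h (- (a + 1) / (2 * b)).
  rewrite c0 mulr0 addr0 (_ : 2 * _ * b = - (a + 1)); last by field.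
  by move=> h1; exfalso; lra.
have c_gt0 : 0 < c.
  rewrite lt0r c0 /= leNgt; apply/negP => cn.
  pose t := 1 - a / c.
  have a0 : 0 <= a by have := h 0; rewrite mulr0 mul0r expr0n mul0r !addr0.
  have ct : c * t = c - a by rewrite /t; field; rewrite c0.
  have := h t; have := h (- t).
  have -> : (- t) ^+ 2 * c = t * (c * t) by ring.
  have -> : t ^+ 2 * c = t * (c * t) by ring.
  have t1 : 1 <= t by rewrite /t; have := ltW cn; rewrite -invr_le0; nra.
  rewrite ct; nra.
have := h (- b / c).
rewrite (_ : a + _ + _ = a - b ^+ 2 / c); last by field.
by rewrite subr_ge0 ler_pdivrMr.
Qed.

(** First-order optimality: along a segment that starts at a minimizer, the
    increase is t b + t^2 a, and b is the initial slope. *)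
Lemma ge0_of_quadratic a b :
  (forall t, 0 < t <= 1 -> 0 <= t * b + t ^+ 2 * a) -> 0 <= b.
Proof.
move=> h; rewrite leNgt; apply/negP => b0.
pose t := Num.min 1 (- b / (2 * (`|a| + 1))).
have a1 : 0 < 2 * (`|a| + 1) by rewrite mulr_gt0// ltr_wpDl.
have t0 : 0 < t by rewrite lt_min ltr01 divr_gt0// oppr_gt0.
have t1 : t <= 1 by rewrite ge_min lexx.
have tb : t * (2 * (`|a| + 1)) <= - b by rewrite -ler_pdivlMr// ge_min lexx orbT.
have := h t; rewrite t0 t1 => /(_ isT).
rewrite expr2 -mulrA -mulrDr pmulr_rge0// => hh.
have : t * a <= t * `|a| by rewrite ler_wpM2l ?ler_norm// ltW.
nra.
Qed.

Lemma eq0_of_quadratic a b : (forall t, 0 <= t * b + t ^+ 2 * a) -> b = 0.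
Proof.
move=> h; apply/eqP; rewrite eq_le; apply/andP; split.
  rewrite -oppr_ge0; apply: (@ge0_of_quadratic a) => t _.
  by have := h (- t); rewrite sqrrN mulNr mulrN.
by apply: (@ge0_of_quadratic a) => t _; exact: h.
Qed.

Lemma cvg_le_lim (F : set_system nat) (FF : ProperFilter F) (u v : nat -> R) a b :
  (forall n, u n <= v n) -> u @ F --> a -> v @ F --> b -> a <= b.
Proof. by move=> uv ua vb; apply: (ler_cvg_to ua vb); apply: nearW. Qed.

End RealLemmas.

Lemma weighted_young (R : realFieldType) (a b x y : R) :
  0 < a -> 1 <= a * b -> 2 * (x * y) <= a * x ^+ 2 + b * y ^+ 2.
Proof.
move=> a0 ab; rewrite -subr_ge0 -(pmulr_rge0 _ a0).
have -> : a * (a * x ^+ 2 + b * y ^+ 2 - 2 * (x * y)) =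
  (a * x - y) ^+ 2 + (a * b - 1) * y ^+ 2 by ring.
by rewrite addr_ge0 ?sqr_ge0// mulr_ge0 ?sqr_ge0// subr_ge0.
Qed.

(** * Linear maps and inner products *)

Section Linear.
Variables (R : realType) (H G : lmodType R) (f : H -> G).
Hypothesis f_lin : linear f.

Lemma linD x y : f (x + y) = f x + f y.
Proof. by have := f_lin 1 x y; rewrite !scale1r. Qed.

Lemma lin0 : f 0 = 0.
Proof. by apply: (addrI (f 0)); rewrite -linD !addr0. Qed.

Lemma linZ a x : f (a *: x) = a *: f x.
Proof. by have := f_lin a x 0; rewrite lin0 !addr0. Qed.

Lemma linN x : f (- x) = - f x.
Proof. by rewrite -scaleN1r linZ scaleN1r. Qed.

Lemma linB x y : f (x - y) = f x - f y.
Proof. by rewrite linD linN. Qed.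

End Linear.

Section Inner.
Variables (R : realType) (H : hilbertType R).
Implicit Types (x y z : H) (a : R).

Lemma innerC x y : '<x, y> = '<y, x>.
Proof. by rewrite (hermC (@inner R H)) expr0 mul1r. Qed.

Lemma innerDl x y z : '<x + y, z> = '<x, z> + '<y, z>.
Proof. exact: linearDl. Qed.

Lemma innerDr x y z : '<z, x + y> = '<z, x> + '<z, y>.
Proof. exact: linearDr. Qed.

Lemma innerZl a x z : '<a *: x, z> = a * '<x, z>.
Proof. exact: linearZl_LR. Qed.

Lemma innerZr a x z : '<z, a *: x> = a * '<z, x>.
Proof. by rewrite innerC innerZl innerC. Qed.

Lemma innerNl x z : '<- x, z> = - '<x, z>.
Proof. exact: linearNl. Qed.

Lemma innerNr x z : '<z, - x> = - '<z, x>.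
Proof. exact: linearNr. Qed.

Lemma inner0l z : '<0, z> = 0.
Proof. exact: linear0l. Qed.

Lemma inner0r z : '<z, 0> = 0.
Proof. exact: linear0r. Qed.

(** Vector identities are proved by testing them against an arbitrary vector
    ([inner_ext]), expanding with this multirule and calling [ring] or [lra] on
    the resulting real identities. *)
Definition innerE := (innerDl, innerDr, innerNl, innerNr, innerZl, innerZr).

Lemma inner_ge0 x : 0 <= '<x, x>.
Proof. by rewrite inner_norm sqr_ge0. Qed.

Lemma inner_le0 x : '<x, x> <= 0 -> x = 0.
Proof.
move=> h; apply/normr0_eq0/eqP; rewrite -sqrf_eq0 eq_le.
by rewrite sqr_ge0 -inner_norm h.
Qed.

Lemma inner_suml (I : finType) (F : I -> H) z :
  '<\sum_i F i, z> = \sum_i '<F i, z>.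
Proof. exact: linear_sumlz. Qed.

Lemma inner_ext x y : (forall z, '<x, z> = '<y, z>) -> x = y.
Proof.
move=> h; apply/subr0_eq/inner_le0.
by rewrite innerDl innerNl h subrr.
Qed.

Lemma sqrnormD x y : `|x + y| ^+ 2 = `|x| ^+ 2 + 2 * '<x, y> + `|y| ^+ 2.
Proof. rewrite -!inner_norm !innerE (innerC y x); ring. Qed.

Lemma cauchy_schwarz_form (T : H -> H) x y : linear T -> self_adjoint T ->
  (forall x, 0 <= '<T x, x>) -> '<T x, y> ^+ 2 <= '<T x, x> * '<T y, y>.
Proof.
move=> T_lin T_sym T_ge0; apply: discriminant_le => t.
have := T_ge0 (x + t *: y); rewrite (linD T_lin) (linZ T_lin) !innerE.
by rewrite (T_sym y x) (innerC y); congr (0 <= _); ring.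
Qed.

Lemma cauchy_schwarz x y : '<x, y> <= `|x| * `|y|.
Proof.
apply: (le_trans (ler_norm _)); rewrite -ler_sqr ?nnegrE ?mulr_ge0//.
rewrite real_normK ?num_real// exprMn -!inner_norm.
by apply: (@cauchy_schwarz_form id) => // u; exact: inner_ge0.
Qed.

Lemma abs_inner_le x y : `|'<x, y>| <= `|x| * `|y|.
Proof.
rewrite ler_norml cauchy_schwarz andbT lerNl -innerNl.
by rewrite (le_trans (cauchy_schwarz _ _))// normrN.
Qed.

(** The Cauchy-Schwarz inequality for the form of T, applied to x and T x. *)
Lemma sqrnorm_le_form (T : H -> H) M x : linear T -> self_adjoint T ->
  (forall x, 0 <= '<T x, x>) -> (forall x, '<T x, x> <= M * `|x| ^+ 2) ->
  `|T x| ^+ 2 <= M * '<T x, x>.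
Proof.
move=> T_lin T_sym T_ge0 T_le.
have [->|Tx0] := eqVneq (T x) 0.
  by rewrite inner0l mulr0 normr0 expr0n.
have := cauchy_schwarz_form x (T x) T_lin T_sym T_ge0.
rewrite inner_norm => h.
have : `|T x| ^+ 2 * `|T x| ^+ 2 <= `|T x| ^+ 2 * (M * '<T x, x>).
  rewrite -expr2 (le_trans h)//.
  by rewrite mulrC mulrA (mulrC _ M) ler_wpM2r// T_le.
by rewrite ler_pM2l// exprn_gt0// normr_gt0.
Qed.

Lemma inner_cvg (F : set_system nat) (FF : Filter F) (u v : nat -> H) x y :
  u @ F --> x -> v @ F --> y -> (fun n => '<u n, v n>) @ F --> '<x, y>.
Proof.
move=> ux vy.
have e : (fun n => '<u n, v n>) = (fun n => 2^-1 * (`|u n + v n| ^+ 2 - `|u n| ^+ 2 -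
  `|v n| ^+ 2)).
  by apply/funext => n; rewrite sqrnormD; field.
rewrite e (_ : '<x, y> = 2^-1 * (`|x + y| ^+ 2 - `|x| ^+ 2 - `|y| ^+ 2)); last first.
  by rewrite sqrnormD; field.
have sq (w : nat -> H) z : w @ F --> z -> (fun n => `|w n| ^+ 2) @ F --> `|z| ^+ 2.
  by move=> wz; apply: cvgM; exact: cvg_norm.
apply: cvgM; first exact: cvg_cst.
by apply: cvgB; [apply: cvgB|]; apply: sq => //; exact: cvgD.
Qed.

(** * Completeness: fixed points, minimizers, Riesz representation *)

Lemma cauchy_sq_cvg (u : nat -> H) (t : nat -> R) :
  (forall m n, (n <= m)%N -> `|u m - u n| ^+ 2 <= t n) -> t @ \oo --> 0 ->
  cvgn u.
Proof.
move=> h t0; apply/cauchy_cvgP/cauchy_exP => e e0.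
have /cvgrPdist_lt /(_ (e ^+ 2)) := t0; rewrite exprn_gt0// => /(_ isT) [N _ hN].
exists (u N), N => // m /= Nm; rewrite -ball_normE /= distrC.
rewrite -ltr_sqr ?nnegrE ?(ltW e0)//.
apply: (le_lt_trans (h _ _ Nm)); apply: (le_lt_trans (ler_norm _)).
by have := hN N (leqnn N); rewrite sub0r normrN.
Qed.

Lemma contraction_fixpoint (f : H -> H) (q : R) : 0 <= q -> q < 1 ->
  (forall x y, `|f x - f y| <= q * `|x - y|) -> exists x, f x = x.
Proof.
move=> q0 q1 hf.
have fs : set_fun [set: H] [set: H] f by [].
pose g : {fun [set: H] >-> [set: H]} := HB.pack f (isFun.Build _ _ _ _ f fs).
have ctr : is_contraction g.
  exists (NngNum q0); split => //= -[x y] _ /=; exact: hf.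
have [||p _ pf] := banach_fixed_point ctr; first exact: closedT.
  by exists 0.
by exists p.
Qed.

(** A minimizing sequence is Cauchy, by the strong midpoint convexity. The
    function is given by the relation [S x t], read as: its value at x is at
    most t. This describes suprema of possibly infinite families of affine
    functions, which may be infinite at some points, without extended reals. *)
Lemma argmin_exists (S : H -> R -> Prop) (c b : R) : 0 < c ->
  (exists x t, S x t) -> (forall x t, S x t -> b <= t) ->
  (forall x y s t, S x s -> S y t ->
    S (2^-1 *: (x + y)) ((s + t) / 2 - c * `|x - y| ^+ 2)) ->
  (forall (u : nat -> H) (s : nat -> R) (x : H) (t : R), (forall n, S (u n) (s n)) ->
    u @ \oo --> x -> s @ \oo --> t -> S x t) ->
  exists x t, S x t /\ forall y s, S y s -> t <= s.
Proof.
move=> c0 [x0 [t0 S0]] Sb Smid Scl.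
pose E := [set t | exists x, S x t].
have E0 : has_inf E by split; [exists t0, x0|exists b => t [x /Sb]].
have inf_le x t : S x t -> inf E <= t.
  by move=> h; apply: ge_inf; [case: E0|exists x].
have /choice[u hu] : forall n : nat, exists xt : H * R,
    S xt.1 xt.2 /\ xt.2 < inf E + n.+1%:R^-1.
  move=> n; have n0 : (0 : R) < n.+1%:R^-1 by rewrite invr_gt0.
  have [t [x Sxt] tlt] := inf_adherent n0 E0.
  by exists (x, t).
have h0 : (fun n : nat => c^-1 * n.+1%:R^-1) @ \oo --> (0 : R).
  rewrite -[0](mulr0 c^-1); apply: cvgM; [exact: cvg_cst|exact: cvg_harmonic].
have /cvg_ex[x ux] : cvgn (fun n => (u n).1).
  apply: cauchy_sq_cvg h0 => m n nm.
  have [Sm tm] := hu m; have [Sn tn] := hu n.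
  have := inf_le _ _ (Smid _ _ _ _ Sm Sn).
  have mn : m.+1%:R^-1 <= n.+1%:R^-1 :> R by rewrite lef_pV2 ?posrE// ler_nat.
  rewrite ler_pdivlMl//; move: tm tn mn; move: (u m).2 (u n).2 (n.+1%:R^-1)
    (m.+1%:R^-1) (_ ^+ 2) (inf E) => a1 a2 a3 a4 a5 a6; lra.
exists x, (inf E); split; last by move=> y s; exact: inf_le.
apply: (Scl (fun n => (u n).1) (fun n => (u n).2)) => //.
  by move=> n; have [] := hu n.
have l : (fun n : nat => inf E + n.+1%:R^-1) @ \oo --> inf E.
  rewrite -[X in _ --> X]addr0; apply: cvgD; [exact: cvg_cst|exact: cvg_harmonic].
apply: (squeeze_cvgr _ (cvg_cst _) l).
apply: nearW => n; have [Sn /ltW ->] := hu n; rewrite andbT; exact: inf_le Sn.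
Qed.

(** The representing vector minimizes |x|^2 - 2 f x. *)
Lemma riesz (f : H -> R) (M : R) : (forall a x y, f (a *: x + y) = a * f x + f y) ->
  (forall x, `|f x| <= M * `|x|) -> exists x, forall y, f y = '<x, y>.
Proof.
move=> fl fM.
have fD x y : f (x + y) = f x + f y by rewrite -[x]scale1r fl mul1r scale1r.
have f0 : f 0 = 0 by apply: (addrI (f 0)); rewrite -fD !addr0.
have fZ a x : f (a *: x) = a * f x by rewrite -[a *: x]addr0 fl f0 addr0.
have fB x y : f (x - y) = f x - f y by rewrite -scaleN1r addrC fl mulN1r addrC.
have [|||||x [t [St tmin]]] := @argmin_exists
  (fun x t => `|x| ^+ 2 - 2 * f x <= t) 4^-1 (- M ^+ 2).
- by [].
- by exists 0; eexists; exact: lexx.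
- move=> x t; apply: le_trans; have := fM x; rewrite ler_norml => /andP[_].
  have := sqr_ge0 (M - `|x|); lra.
- move=> x y s t hs ht; rewrite fZ fD.
  move: hs ht; rewrite -!inner_norm !innerE (innerC y x); lra.
- move=> u s x t h ux st.
  apply: (cvg_le_lim _ h _ st).
  have fu : (f \o u) @ \oo --> f x.
    apply/cvgrPdist_le => e e0.
    have M1 : 0 < `|M| + 1 by rewrite ltr_wpDl.
    have /cvgrPdist_le /(_ (e / (`|M| + 1))) := ux; rewrite divr_gt0// => /(_ isT).
    apply: filterS => n; rewrite ler_pdivlMr// => hn.
    rewrite -fB (le_trans (fM _))//; have := ler_norm M; have := normr_ge0 (x - u n); nra.
  apply: cvgB; first by apply: cvgM; exact: cvg_norm.
  by apply: cvgM => //; exact: cvg_cst.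
exists x => y; apply/eqP; rewrite -subr_eq0; apply/eqP.
rewrite -[LHS]opprK opprB; apply/eqP; rewrite oppr_eq0; apply/eqP.
apply: (@eq0_of_quadratic _ (2^-1 * `|y| ^+ 2)) => s.
have := tmin (x + s *: y) _ (lexx _).
rewrite -inner_norm !innerE fD fZ inner_norm inner_norm (innerC y x).
lra.
Qed.

End Inner.

(** * Quadratic forms of symmetric operators *)

Lemma formD (R : realType) (H : hilbertType R) (W : H -> H) x y :
  linear W -> self_adjoint W ->
  '<W (x + y), x + y> = '<W x, x> + 2 * '<W x, y> + '<W y, y>.
Proof.
move=> W_lin W_sym; rewrite (linD W_lin) !innerDl !innerDr (W_sym y x).
by rewrite (innerC y); ring.
Qed.

Lemma formBZ (R : realType) (H : hilbertType R) (W : H -> H) (a : R) x y :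
  linear W -> self_adjoint W ->
  '<W (x - a *: y), x - a *: y> =
  '<W x, x> - 2 * a * '<W x, y> + a ^+ 2 * '<W y, y>.
Proof.
move=> W_lin W_sym; rewrite formD// (linN W_lin) (linZ W_lin).
by rewrite !(innerNl, innerNr, innerZl, innerZr); ring.
Qed.

Lemma formB (R : realType) (H : hilbertType R) (W : H -> H) x y :
  linear W -> self_adjoint W ->
  '<W (x - y), x - y> = '<W x, x> - 2 * '<W x, y> + '<W y, y>.
Proof.
by move=> W_lin W_sym; rewrite -[y]scale1r formBZ// !scale1r; ring.
Qed.

Lemma sqrt_form_triangle (R : realType) (H : hilbertType R) (W : H -> H) a b :
  linear W -> self_adjoint W -> (forall x, 0 <= '<W x, x>) ->
  Num.sqrt '<W (a + b), a + b> <= Num.sqrt '<W a, a> + Num.sqrt '<W b, b>.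
Proof.
move=> W_lin W_sym W_ge0.
rewrite -ler_sqr ?nnegrE ?addr_ge0 ?sqrtr_ge0// sqrrD !sqr_sqrtr//.
rewrite formD//.
suff : '<W a, b> <= Num.sqrt '<W a, a> * Num.sqrt '<W b, b> by lra.
rewrite -sqrtrM// (le_trans (ler_norm _))// -sqrtr_sqr ler_wsqrtr//.
exact: cauchy_schwarz_form.
Qed.

(** * Finite Hilbert direct sums *)

(** A fresh name for the dependent product, so that it can carry the norm
    (sum_i |k i|^2)^(1/2) and not the structures already attached to function
    types. *)
Definition dsum (R : realType) (I : finType) (E : I -> hilbertType R) : Type :=
  forall i, E i.

Section DSum.
Context {R : realType} {I : finType} {E : I -> hilbertType R}.
Local Notation K := (dsum E).
Implicit Types k l : K.

HB.instance Definition _ := gen_eqMixin K.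
HB.instance Definition _ := gen_choiceMixin K.

Definition dsum0 : K := fun i => 0.
Definition dsum_opp k : K := fun i => - k i.
Definition dsum_add k l : K := fun i => k i + l i.
Definition dsum_scale (a : R) k : K := fun i => a *: k i.

Lemma dsum_addA : associative dsum_add.
Proof. by move=> k l h; apply: functional_extensionality_dep => i; exact: addrA. Qed.

Lemma dsum_addC : commutative dsum_add.
Proof. by move=> k l; apply: functional_extensionality_dep => i; exact: addrC. Qed.

Lemma dsum_add0 : left_id dsum0 dsum_add.
Proof. by move=> k; apply: functional_extensionality_dep => i; exact: add0r. Qed.

Lemma dsum_addN : left_inverse dsum0 dsum_opp dsum_add.
Proof. by move=> k; apply: functional_extensionality_dep => i; exact: addNr. Qed.

HB.instance Definition _ :=
  GRing.isZmodule.Build K dsum_addA dsum_addC dsum_add0 dsum_addN.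

Lemma dsum_scaleA (a b : R) k : dsum_scale a (dsum_scale b k) = dsum_scale (a * b) k.
Proof. by apply: functional_extensionality_dep => i; exact: scalerA. Qed.

Lemma dsum_scale1 : left_id 1 dsum_scale.
Proof. by move=> k; apply: functional_extensionality_dep => i; exact: scale1r. Qed.

Lemma dsum_scaleDr : right_distributive dsum_scale +%R.
Proof. by move=> a k l; apply: functional_extensionality_dep => i; exact: scalerDr. Qed.

Lemma dsum_scaleDl k : {morph dsum_scale^~ k : a b / a + b}.
Proof. by move=> a b; apply: functional_extensionality_dep => i; exact: scalerDl. Qed.

HB.instance Definition _ := GRing.Zmodule_isLmodule.Build R K
  dsum_scaleA dsum_scale1 dsum_scaleDr dsum_scaleDl.

Definition dsum_inner k l : R := \sum_i '<k i, l i>.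
Definition dsum_norm k : R := Num.sqrt (\sum_i `|k i| ^+ 2).

Lemma dsum_inner_linear_l l : linear_for *%R (dsum_inner ^~ l).
Proof.
move=> a k h; rewrite /dsum_inner mulr_sumr -big_split /=.
by apply: eq_bigr => i _; rewrite innerDl innerZl.
Qed.

Lemma dsum_innerC k l : dsum_inner k l = dsum_inner l k.
Proof. by apply: eq_bigr => i _; rewrite innerC. Qed.

Lemma dsum_inner_linear_r l : linear_for (@idfun R \; *%R) (dsum_inner l).
Proof. by move=> a k h; rewrite !(dsum_innerC l) dsum_inner_linear_l. Qed.

HB.instance Definition _ := bilinear_isBilinear.Build R K K R _ _ dsum_inner
  (dsum_inner_linear_l, dsum_inner_linear_r).

Lemma dsum_inner_herm k l : dsum_inner k l = (-1) ^+ false * idfun (dsum_inner l k).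
Proof. by rewrite expr0 mul1r dsum_innerC. Qed.

HB.instance Definition _ := isHermitianSesquilinear.Build R K false idfun
  dsum_inner dsum_inner_herm.

Lemma dsum_inner_norm k : dsum_inner k k = dsum_norm k ^+ 2.
Proof.
rewrite /dsum_norm sqr_sqrtr; last by apply: sumr_ge0 => i _; exact: sqr_ge0.
by apply: eq_bigr => i _; rewrite inner_norm.
Qed.

Lemma dsum_coord_le k i : `|k i| <= dsum_norm k.
Proof.
rewrite -ler_sqr ?nnegrE ?sqrtr_ge0// -dsum_inner_norm /dsum_inner.
by rewrite (bigD1 i)//= inner_norm lerDl sumr_ge0// => j _; exact: inner_ge0.
Qed.

Lemma dsum_norm_eq0 k : dsum_norm k = 0 -> k = 0.
Proof.
move=> k0; apply: functional_extensionality_dep => i.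
by apply/normr0_eq0/eqP; rewrite eq_le normr_ge0 andbT -k0 dsum_coord_le.
Qed.

Lemma dsum_inner_gt0 k : k != 0 -> 0 < dsum_inner k k.
Proof.
move=> k0; rewrite dsum_inner_norm exprn_gt0// lt0r sqrtr_ge0 andbT.
by apply: contra k0 => /eqP/dsum_norm_eq0/eqP.
Qed.

HB.instance Definition _ := isDotProduct.Build R K dsum_inner dsum_inner_gt0.

Lemma dsum_inner_quadratic k l (t : R) :
  dsum_inner (k + t *: l) (k + t *: l) =
  dsum_inner k k + 2 * t * dsum_inner k l + t ^+ 2 * dsum_inner l l.
Proof.
rewrite /dsum_inner !mulr_sumr -!big_split /=; apply: eq_bigr => i _.
by rewrite !innerE (innerC (l i) (k i)); ring.
Qed.

Lemma dsum_normD k l : dsum_norm (k + l) <= dsum_norm k + dsum_norm l.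
Proof.
rewrite -ler_sqr ?nnegrE ?addr_ge0 ?sqrtr_ge0// sqrrD -!dsum_inner_norm.
rewrite -[l in dsum_inner (k + l)]scale1r -[l in dsum_inner _ (k + l)]scale1r.
rewrite dsum_inner_quadratic.
suff : dsum_inner k l <= dsum_norm k * dsum_norm l by lra.
apply: (le_trans (ler_norm _)).
rewrite -ler_sqr ?nnegrE ?mulr_ge0 ?sqrtr_ge0// real_normK ?num_real// exprMn.
rewrite -!dsum_inner_norm; apply: discriminant_le => t.
by rewrite -dsum_inner_quadratic dsum_inner_norm sqr_ge0.
Qed.

Lemma dsum_normZ (a : R) k : dsum_norm (a *: k) = `|a| * dsum_norm k.
Proof.
rewrite /dsum_norm -sqrtr_sqr -sqrtrM ?sqr_ge0// mulr_sumr; congr Num.sqrt.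
by apply: eq_bigr => i _; rewrite normrZ exprMn real_normK ?num_real.
Qed.

HB.instance Definition _ :=
  Lmodule_isNormed.Build R K dsum_normD dsum_normZ dsum_norm_eq0.

Lemma dsum_norm_le_sum k : dsum_norm k <= \sum_i `|k i|.
Proof.
have S0 : 0 <= \sum_i `|k i| by exact: sumr_ge0.
rewrite -(ger0_norm S0) -sqrtr_sqr ler_wsqrtr// expr2 mulr_suml.
apply: ler_sum => i _; rewrite expr2 ler_wpM2l// (bigD1 i)//= lerDl.
exact: sumr_ge0.
Qed.

Lemma dsum_complete (F : set_system K) :
  ProperFilter F -> cauchy F -> cvg F.
Proof.
move=> FF /cauchyP Fc; apply/cvg_ex.
pose l : K := fun i => lim ((fun k : K => k i) @ F).
have li i : (fun k : K => k i) @ F --> l i.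
  apply: (iffLR (cauchy_cvgP _)); apply/cauchy_exP => e e0.
  have [x Fx] := Fc _ e0; exists (x i); move: Fx; rewrite /= nbhs_simpl;
    apply: (@filterS _ F) => k.
  rewrite -!ball_normE /=; apply: le_lt_trans; exact: (dsum_coord_le (x - k)).
exists l; apply/cvgrPdist_lt => e e0.
pose e' := e / (#|I|.+1)%:R.
have e'0 : 0 < e' by rewrite divr_gt0.
have : \forall k \near F, forall i, `|l i - k i| < e'.
  apply: filter_forall => i; have /cvgrPdist_lt := li i; exact.
apply: filterS => k kl; apply: (le_lt_trans (dsum_norm_le_sum _)).
apply: (@le_lt_trans _ _ (\sum_(i : I) e')).
  by apply: ler_sum => i _; apply/ltW/kl.
rewrite sumr_const -[e' *+ _]mulr_natr /e' -mulrA gtr_pMr// mulrC ltr_pdivrMr//.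
by rewrite mul1r ltr_nat.
Qed.

HB.instance Definition _ := Uniform_isComplete.Build K dsum_complete.

Lemma dsum_inner_normE k :
  (dsum_inner : {dot K for @idfun R}) k k = `|k| ^+ 2.
Proof. exact: dsum_inner_norm. Qed.

HB.instance Definition _ :=
  CompleteNormedModule_isHilbert.Build R K dsum_inner_normE.

End DSum.

Lemma dsum_innerE (R : realType) (I : finType) (E : I -> hilbertType R) (k l : dsum E) :
  '<k, l> = \sum_i '<k i, l i>.
Proof. by []. Qed.

(** * Maximal monotonicity and the theorem of Minty *)

Section MaximallyMonotone.
Variables (R : realType) (H : hilbertType R).
Implicit Types (A : H -> set H).

(** Maximality in its usable form: a pair that is monotonically related to the
    whole graph belongs to it, since adding it would keep the operator
    monotone. *)
Lemma maximally_monotoneP A : maximally_monotone A <->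
  Defs.monotone A /\
  forall x u, (forall y v, A y v -> 0 <= '<x - y, u - v>) -> A x u.
Proof.
split=> [[A_mon A_max]|[A_mon A_crit]]; split => //.
  move=> x u xu_rel; apply: contrapT => nAxu.
  pose B y v := A y v \/ (y = x /\ v = u).
  apply: (A_max (fun y => [set v | B y v])).
    move=> y v y' v' /= [Ayv|[-> ->]] [Ay'v'|[-> ->]].
    - exact: A_mon.
    - by rewrite -(opprB x) -(opprB u) innerNl innerNr opprK xu_rel.
    - exact: xu_rel.
    - by rewrite !subrr inner0l.
  split=> [[y v] /= Ayv|/(_ (x, u)) /=]; first by left.
  by move=> /(_ (or_intror (conj erefl erefl))).
move=> B B_mon [AB nBA]; apply: nBA => -[x u] /= Bxu.
by apply: A_crit => y v Ayv; apply: B_mon => //; exact: (AB (y, v)).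
Qed.

Lemma maximally_monotone_opinv A :
  maximally_monotone A -> maximally_monotone (opinv A).
Proof.
move=> /maximally_monotoneP[A_mon A_crit]; apply/maximally_monotoneP.
split=> [x u y v xu yv|x u xu_rel]; first by rewrite innerC; exact: A_mon.
by apply: A_crit => y v Ayv; rewrite innerC; exact: xu_rel.
Qed.

(** The Fitzpatrick function F (x, u), the supremum over (y, v) in the graph of
    <x, v> + <y, u> - <y, v>, equals <x, u> on the graph and dominates it
    everywhere. Let (x0, u0) minimize F + |.|^2 / 2 over H + H. Optimality along
    the segment to a point (y, v) of the graph, together with F
    (x0, u0) >= <x0, u0>, gives <y + u0, v + x0> >= |x0 + u0|^2. So (-u0, -x0)
    is in the graph by maximality, and taking it for (y, v) gives
    x0 + u0 = 0. *)
Lemma minty_zero A : maximally_monotone A -> exists x u, A x u /\ x + u = 0.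
Proof.
move=> /maximally_monotoneP[A_mon A_crit].
have [y0 [v0 A0]] : exists y v, A y v.
  apply: contrapT => nA; apply: (nA); exists 0, 0; apply: A_crit => y v Ayv.
  by exfalso; apply: nA; exists y, v.
pose K : hilbertType R := dsum (fun _ : bool => H).
pose pair (x u : H) : K := fun b => if b then x else u.
have pairE (X : K) x u : '<X, pair x u> = '<X true, x> + '<X false, u>.
  by rewrite dsum_innerE big_bool.
pose S (X : K) t := forall y v, A y v ->
  '<X, pair v y> - '<y, v> + 2^-1 * `|X| ^+ 2 <= t.
(* [8^-1] is the modulus of midpoint convexity of |.|^2 / 2; the lower bound
   comes from the affine function attached to (y0, v0). *)
have [|||||X0 [t0 [SX0 t0_min]]] :=
  @argmin_exists R K S 8^-1 (- (2^-1 * `|pair v0 y0| ^+ 2) - '<y0, v0>).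
- by [].
- exists (pair y0 v0), ('<y0, v0> + 2^-1 * `|pair y0 v0| ^+ 2) => y v Ayv.
  rewrite lerD2r pairE /= (innerC v0).
  have := A_mon _ _ _ _ A0 Ayv; rewrite !innerE; lra.
- move=> X t /(_ _ _ A0); apply: le_trans.
  have := sqr_ge0 `|X + pair v0 y0|; rewrite sqrnormD; lra.
- move=> X Y s t SX SY y v Ayv; have := SX _ _ Ayv; have := SY _ _ Ayv.
  rewrite -!inner_norm !innerE (innerC Y X); lra.
- move=> u s X t Su uX st y v Ayv.
  apply: (cvg_le_lim _ (fun n => Su n _ _ Ayv) _ st).
  apply: cvgD.
    apply: cvgB; last exact: cvg_cst.
    by apply: inner_cvg => //; exact: cvg_cst.
  by apply: cvgM; [exact: cvg_cst|apply: cvgM; exact: cvg_norm].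
set x0 := X0 true; set u0 := X0 false.
pose f0 := t0 - 2^-1 * `|X0| ^+ 2.
have f0_ub y v : A y v -> '<x0, v> + '<u0, y> - '<y, v> <= f0.
  by move=> /SX0; rewrite pairE /f0 -/x0 -/u0; lra.
have f0_ge : '<x0, u0> <= f0.
  rewrite leNgt; apply/negP => f0_lt.
  have Axu : A x0 u0.
    apply: A_crit => y v /f0_ub; rewrite !innerE (innerC y u0); lra.
  have := f0_ub _ _ Axu; rewrite (innerC u0); lra.
have X0E : '<X0, X0> = '<x0, x0> + '<u0, u0> by rewrite dsum_innerE big_bool.
(* [f0] is the value of F at X0; this is the subgradient inequality at X0. *)
have f0_le y v : A y v ->
    f0 <= '<y, v> + '<x0, y> + '<u0, v> - '<x0, x0> - '<u0, u0>.
  move=> Ayv; pose Y := pair y v.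
  rewrite -subr_ge0.
  apply: (@ge0_of_quadratic _ (2^-1 * `|Y - X0| ^+ 2)) => t /andP[t_gt0 t_le1].
  have /t0_min : S (X0 + t *: (Y - X0))
      ((1 - t) * f0 + t * '<y, v> + 2^-1 * `|X0 + t *: (Y - X0)| ^+ 2).
    move=> y' v' A'; rewrite lerD2r innerDl innerZl innerDl innerNl !pairE /=.
    rewrite -/x0 -/u0.
    have h1 := f0_ub _ _ A'; have h2 := A_mon _ _ _ _ Ayv A'.
    rewrite !innerE (innerC y' v) in h2.
    set a := '<x0, v'> + '<u0, y'> in h1 *; nra.
  rewrite sqrnormD innerZr innerDr innerNr pairE X0E -/x0 -/u0 /f0.
  rewrite -!inner_norm !innerZl !innerZr X0E; lra.
have key y v : A y v -> '<x0 + u0, x0 + u0> <= '<- u0 - y, - x0 - v>.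
  move=> /f0_le; rewrite !innerE (innerC u0 x0) (innerC y x0) ; lra.
have A1 : A (- u0) (- x0).
  by apply: A_crit => y v /key; apply: le_trans; exact: inner_ge0.
exists (- u0), (- x0); split => //; rewrite -opprD addrC.
have := key _ _ A1; rewrite subrr inner0l => /inner_le0 ->.
by rewrite oppr0.
Qed.

(** Apply the previous lemma to x |-> c A x - w. *)
Lemma minty A (c : R) w : maximally_monotone A -> 0 < c ->
  exists x u, A x u /\ x + c *: u = w.
Proof.
move=> /maximally_monotoneP[A_mon A_crit] c_gt0.
have c0 : c != 0 by rewrite gt_eqF.
have [|x [u [Axu xu]]] := @minty_zero (fun x => [set u | A x (c^-1 *: (u + w))]).
  apply/maximally_monotoneP; split=> [x u y v /= Axu Ayv|x u xu_rel /=].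
    have := A_mon _ _ _ _ Axu Ayv.
    by rewrite -scalerBr innerZr pmulr_rge0 ?invr_gt0// opprD addrACA subrr addr0.
  apply: A_crit => y v Ayv.
  have := xu_rel y (c *: v - w) _; rewrite /= subrK scalerA mulVf// scale1r.
  move=> /(_ Ayv) h; rewrite -(pmulr_rge0 _ c_gt0) -innerZr scalerBr scalerA.
  by rewrite mulfV// scale1r; move: h; rewrite !innerE; lra.
exists x, (c^-1 *: (u + w)); split => //.
by rewrite scalerA mulfV// scale1r addrA xu add0r.
Qed.

End MaximallyMonotone.

(** * Positive operators and resolvents *)

Lemma posop_linear (R : realType) (H : hilbertType R) (alpha : R) (U : H -> H) :
  posop alpha U -> linear U.
Proof. by case=> [[]]. Qed.

Section PositiveOperators.
Variables (R : realType) (H : hilbertType R).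
Implicit Types (A : H -> set H).

(** For c above the norm of U, the operator Id - U / c lies between 0 and
    (1 - alpha / c) Id, so its norm is at most q = 1 - alpha / c. This makes the
    inverse, the square root and the resolvents in the metric of U accessible to
    fixed point iterations. *)
Lemma posop_near_scalar (U : H -> H) (alpha : R) : 0 < alpha -> posop alpha U ->
  exists c q : R, [/\ 0 < c, 0 <= q, q < 1 &
    forall x, `|x - c^-1 *: U x| <= q * `|x|].
Proof.
move=> alpha_gt0 [[U_lin [M UM]] U_sym U_ge].
pose c := `|M| + alpha.
have c_gt0 : 0 < c by rewrite ltr_wpDl.
have c0 : c != 0 by rewrite gt_eqF.
pose q := 1 - c^-1 * alpha.
have c1 : c^-1 * alpha <= 1 by rewrite ler_pdivrMl// mulr1 lerDr.
have ci_gt0 : 0 < c^-1 by rewrite invr_gt0.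
have q0 : 0 <= q by rewrite subr_ge0.
pose T x := x - c^-1 *: U x.
have T_lin : linear T.
  move=> a x y; rewrite /T (linD U_lin) (linZ U_lin) scalerDr opprD scalerBr.
  by rewrite addrACA !scalerA (mulrC a).
have T_sym : self_adjoint T.
  by move=> x y; rewrite /T !innerE (U_sym x y).
have TE x : '<T x, x> = `|x| ^+ 2 - c^-1 * '<U x, x>.
  by rewrite /T !innerE inner_norm.
have T_le x : '<T x, x> <= q * `|x| ^+ 2.
  have := U_ge x; rewrite innerZl inner_norm TE /q mulrBl mul1r => h.
  by rewrite lerD2l lerN2 -mulrA ler_pM2l.
have T_ge0 x : 0 <= '<T x, x>.
  rewrite TE subr_ge0 ler_pdivrMl//.
  apply: (le_trans (cauchy_schwarz _ _)).
  have x0 := normr_ge0 x; have := UM x; have := ler_norm M.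
  rewrite expr2 mulrA => h1 h2; rewrite ler_wpM2r// (le_trans h2)// ler_wpM2r//.
  by rewrite (le_trans h1)// lerDl ltW.
exists c, q; split => //.
  by rewrite /q ltrBlDr ltrDl mulr_gt0.
move=> x; rewrite -ler_sqr ?nnegrE ?mulr_ge0// exprMn.
apply: (le_trans (sqrnorm_le_form x T_lin T_sym T_ge0 T_le)).
by rewrite expr2 -mulrA ler_wpM2l.
Qed.

(** Write U = c (Id - T) with |T| <= q < 1. The equation x + U u = w with u in A
    x says that u is the point where x + c u = w + c T u. By Minty's theorem and
    monotonicity, solving x + c u = w + c T u' for u defines a q-contraction
    u' |-> u, whose fixed point is wanted. *)
Lemma resolvent_exists A U (alpha : R) w : maximally_monotone A -> 0 < alpha ->
  posop alpha U -> exists x u, A x u /\ x + U u = w.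
Proof.
move=> A_max alpha_gt0 U_pos.
have [c [q [c_gt0 q0 q1 Uq]]] := posop_near_scalar alpha_gt0 U_pos.
have [[U_lin _] _ _] := U_pos; have [A_mon _] := A_max.
have /choice[f hf] : forall u', exists xu : H * H,
    A xu.1 xu.2 /\ xu.1 + c *: xu.2 = w + (c *: u' - U u').
  move=> u'; have [x [u [Axu xu]]] := minty (w + (c *: u' - U u')) A_max c_gt0.
  by exists (x, u).
have [|u fu] := @contraction_fixpoint _ H (fun u => (f u).2) q q0 q1.
  move=> u1 u2; have [A1 e1] := hf u1; have [A2 e2] := hf u2.
  have := A_mon _ _ _ _ A1 A2.
  set d := (f u1).2 - (f u2).2; set d' := u1 - u2.
  have -> : (f u1).1 - (f u2).1 = c *: (d' - c^-1 *: U d') - c *: d.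
    apply: inner_ext => z; have := congr1 (fun t => '<t, z>) e1.
    have := congr1 (fun t => '<t, z>) e2.
    rewrite /d /d' (linB U_lin) !innerE => h1 h2.
    have c1 : c * c^-1 = 1 by rewrite mulfV ?gt_eqF.
    by rewrite mulrDr mulrN mulrA c1 mul1r; lra.
  rewrite innerDl innerNl !innerZl inner_norm -mulrBr pmulr_rge0// subr_ge0 => h.
  have := le_trans h (cauchy_schwarz _ _).
  have [->|d0] := eqVneq d 0; first by rewrite normr0 mulr_ge0.
  by rewrite expr2 ler_pM2r ?normr_gt0// => h'; exact: le_trans h' (Uq _).
have [Af e] := hf u; rewrite fu in Af e.
exists (f u).1, u; split => //.
apply: inner_ext => z; have := congr1 (fun t => '<t, z>) e.
rewrite !innerE; lra.
Qed.

(** Controls the effect of an error inside the argument of a resolvent. The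
    inequality for u - u' comes from testing the difference of the two equations
    against u - u'. *)
Lemma resolvent_lipschitz A U (alpha chi : R) p p' u u' :
  Defs.monotone A -> 0 < alpha -> posop alpha U -> 0 <= chi -> (forall x, `|U x| <=
    chi * `|x|) ->
  A p u -> A p' u' ->
  `|p - p'| <= (1 + alpha^-1 * chi) * `|(p + U u) - (p' + U u')|.
Proof.
move=> A_mon alpha_gt0 [[U_lin _] U_sym U_ge] chi_ge0 Uchi Apu Apu'.
set g := p + U u - (p' + U u').
have gE : g = (p - p') + U (u - u').
  by rewrite /g (linB U_lin) opprD addrACA.
have h : alpha * `|u - u'| <= `|g|.
  have := A_mon _ _ _ _ Apu Apu'.
  have -> : p - p' = g - U (u - u') by rewrite gE addrK.
  rewrite innerDl innerNl subr_ge0 => h1.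
  have := le_trans (U_ge _) h1; rewrite innerZl inner_norm => h2.
  have := le_trans h2 (cauchy_schwarz _ _).
  have [->|d0] := eqVneq (u - u') 0; first by rewrite normr0 !mulr0.
  by rewrite expr2 mulrA ler_pM2r ?normr_gt0.
have -> : p - p' = g - U (u - u') by rewrite gE addrK.
apply: (le_trans (ler_normB _ _)); rewrite mulrDl mul1r lerD2l.
apply: (le_trans (Uchi _)).
rewrite -ler_pdivlMl// in h.
by rewrite (mulrC _ chi) -mulrA ler_wpM2l.
Qed.

(** U y = x is a fixed point equation for the contraction
    y |-> x / c + (y - U y / c). *)
Lemma posop_inverse U (alpha : R) : 0 < alpha -> posop alpha U ->
  exists P : H -> H, [/\ cancel P U, cancel U P, linear P, self_adjoint P &
    forall x, 0 <= '<P x, x> <= alpha^-1 * `|x| ^+ 2].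
Proof.
move=> alpha_gt0 U_pos.
have [c [q [c_gt0 q0 q1 Uq]]] := posop_near_scalar alpha_gt0 U_pos.
have [[U_lin _] U_sym U_ge] := U_pos.
have /choice[P PK] : forall x, exists y, U y = x.
  move=> x; have [|y hy] := @contraction_fixpoint _ H
    (fun y => c^-1 *: x + (y - c^-1 *: U y)) q q0 q1.
    move=> y y'; rewrite (_ : _ - _ = (y - y') - c^-1 *: U (y - y')); first exact: Uq.
    by apply: inner_ext => z; rewrite (linB U_lin) !innerE; ring.
  exists y; apply: inner_ext => z; have := congr1 (fun t => c * '<t, z>) hy.
  rewrite /= !innerE !mulrDr mulrN !mulrA mulfV ?gt_eqF// !mul1r; lra.
have U_inj : injective U.
  move=> x y Uxy; apply/subr0_eq/inner_le0.
  have := U_ge (x - y).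
  by rewrite (linB U_lin) Uxy subrr inner0l innerZl pmulr_rle0.
have UK : cancel U P by move=> x; apply: U_inj; rewrite PK.
exists P; split => //.
- by move=> a x y; apply: U_inj; rewrite (linD U_lin) (linZ U_lin) !PK.
- by move=> x y; rewrite -{1}(PK y) -U_sym PK.
move=> x; have := U_ge (P x); rewrite innerZl PK (innerC x) inner_norm => h.
have cs := cauchy_schwarz (P x) x.
rewrite (le_trans _ h) ?mulr_ge0 ?(ltW alpha_gt0)//=.
rewrite (le_trans cs)// expr2 mulrA ler_wpM2r// ler_pdivlMl//.
have := le_trans h cs.
have [->|d0] := eqVneq (P x) 0; first by rewrite normr0 mulr0.
by rewrite expr2 mulrCA ler_pM2l ?normr_gt0 // mulrC.
Qed.

End PositiveOperators.

(** * Operator norms, adjoints and square roots *)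

Section BoundedOperators.
Variable R : realType.
Implicit Types H G K : hilbertType R.

Lemma opnorm_ge H G (L : H -> G) x : bounded_linear L -> `|L x| <= opnorm L * `|x|.
Proof.
move=> [L_lin [M LM]].
have [->|x0] := eqVneq x 0; first by rewrite (lin0 L_lin) !normr0 mulr0.
have nx : 0 < `|x| by rewrite normr_gt0.
rewrite -ler_pdivrMr//; apply: ub_le_sup; last first.
  exists (`|x|^-1 *: x) => /=.
    by rewrite normrZ normfV normr_id mulVf ?gt_eqF.
  by rewrite (linZ L_lin) normrZ normfV normr_id mulrC.
exists `|M| => _ /= [y y1 <-]; apply: (le_trans (LM y)).
apply: (le_trans (ler_wpM2r (normr_ge0 _) (ler_norm M))).
by rewrite -[leRHS]mulr1 ler_wpM2l.
Qed.

Lemma opnorm_ge0 H G (L : H -> G) : bounded_linear L -> 0 <= opnorm L.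
Proof.
move=> [L_lin [M LM]]; apply: ub_le_sup.
  exists `|M| => _ /= [y y1 <-]; apply: (le_trans (LM y)).
  apply: (le_trans (ler_wpM2r (normr_ge0 _) (ler_norm M))).
  by rewrite -[leRHS]mulr1 ler_wpM2l.
by exists 0; rewrite /= ?normr0// (lin0 L_lin) normr0.
Qed.

Lemma bounded_linear_comp H G K (L : H -> G) (M : G -> K) :
  bounded_linear L -> bounded_linear M -> bounded_linear (M \o L).
Proof.
move=> L_bd M_bd; split.
  by move=> a x y /=; rewrite (linD L_bd.1) (linZ L_bd.1) (linD M_bd.1) (linZ M_bd.1).
exists (opnorm M * opnorm L) => x /=.
apply: (le_trans (opnorm_ge _ M_bd)).
by rewrite -mulrA ler_wpM2l ?opnorm_ge0 ?opnorm_ge.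
Qed.

Lemma adjointP H G (L : H -> G) : bounded_linear L -> is_adjoint L (adjoint L).
Proof.
move=> L_bd; apply: (@xgetPex _ (fun=> 0) [set M | is_adjoint L M]).
have /choice[M hM] : forall y : G, exists z : H, forall x, '<L x, y> = '<z, x>.
  move=> y; apply: (@riesz _ _ (fun x => '<L x, y>) (opnorm L * `|y|)).
    by move=> a x x'; rewrite (linD L_bd.1) (linZ L_bd.1) innerDl innerZl.
  move=> x; apply: (le_trans (abs_inner_le _ _)).
  by rewrite mulrAC ler_wpM2r ?opnorm_ge.
by exists M => x y; rewrite hM innerC.
Qed.

Lemma adjoint_linear H G (L : H -> G) : bounded_linear L -> linear (adjoint L).
Proof.
move=> L_bd a x y; apply: inner_ext => z; rewrite innerC -(adjointP L_bd).
rewrite !innerE (innerC (adjoint L x)) (innerC (adjoint L y)).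
by rewrite -!(adjointP L_bd).
Qed.

End BoundedOperators.

Section SquareRoot.
Variables (R : realType) (H : hilbertType R).

(** With T = Id - U / c and |T| <= q < 1, the square root of U is c^(1/2)
    (Id - Z), where Z solves Z = (T + Z^2) / 2. Iterating from 0 stays in the
    ball of radius rho = 1 - (1 - q)^(1/2), which solves q + rho^2 = 2 rho, and
    contracts there with ratio rho < 1. *)
Lemma posop_sqrt_exists (alpha : R) (U : H -> H) : 0 < alpha -> posop alpha U ->
  exists S, posop 0 S /\ S \o S = U.
Proof.
move=> alpha_gt0 U_pos.
have [c [q [c_gt0 q0 q1 Uq]]] := posop_near_scalar alpha_gt0 U_pos.
have [[U_lin _] U_sym U_ge] := U_pos.
have c0 : c != 0 by rewrite gt_eqF.
pose T x := x - c^-1 *: U x.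
have T_lin : linear T.
  by move=> a x y; apply: inner_ext => z; rewrite /T (linD U_lin) (linZ U_lin) !innerE;
    ring.
have T_sym : self_adjoint T by move=> x y; rewrite /T !innerE (U_sym x y).
pose rho := 1 - Num.sqrt (1 - q).
have s_gt0 : 0 < Num.sqrt (1 - q) by rewrite sqrtr_gt0 subr_gt0.
have s_sq : Num.sqrt (1 - q) ^+ 2 = 1 - q by rewrite sqr_sqrtr// subr_ge0 ltW.
have rho_ge0 : 0 <= rho by rewrite /rho; nra.
have rho_lt1 : rho < 1 by rewrite /rho; lra.
have rhoE : q + rho ^+ 2 = 2 * rho by rewrite /rho sqrrB s_sq; ring.
clearbody rho; have inv_ge0 : 0 <= (1 - rho)^-1 by rewrite invr_ge0 subr_ge0 ltW.
pose Y := fix Y n : H -> H :=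
  if n is n'.+1 then fun x => 2^-1 *: (T x + Y n' (Y n' x)) else fun=> 0.
have YS n x : Y n.+1 x = 2^-1 *: (T x + Y n (Y n x)) by [].
have Y_lin n : linear (Y n).
  elim: n => [|n IH] a x y; first by rewrite /= scaler0 addr0.
  rewrite !YS (linD T_lin) (linZ T_lin) !(linD IH) !(linZ IH).
  by apply: inner_ext => z; rewrite !innerE; ring.
have Y_sym n : self_adjoint (Y n).
  elim: n => [|n IH] x y; first by rewrite inner0l inner0r.
  by rewrite !YS innerZl innerZr innerDl innerDr T_sym !IH.
have Y_le n x : `|Y n x| <= rho * `|x|.
  elim: n x => [|n IH] x; first by rewrite normr0 mulr_ge0.
  rewrite YS normrZ ger0_norm ?invr_ge0// ler_pdivrMl//.
  apply: (le_trans (ler_normD _ _)); rewrite mulrA -rhoE mulrDl lerD ?Uq//.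
  by rewrite expr2 -mulrA (le_trans (IH _))// ler_wpM2l.
have Y_diff n x : `|Y n.+1 x - Y n x| <= rho ^+ n * `|x|.
  elim: n x => [|n IH] x.
    rewrite expr0 mul1r; apply: (@le_trans _ _ (rho * `|x|)).
      by have := Y_le 1%N x; rewrite [Y 0%N]/= subr0.
    by rewrite ler_piMl// ltW.
  rewrite [Y n.+2 x]YS {2}[Y n.+1 x]YS -scalerBr opprD addrACA subrr add0r.
  rewrite normrZ ger0_norm ?invr_ge0// ler_pdivrMl//.
  have -> : Y n.+1 (Y n.+1 x) - Y n (Y n x) =
      Y n.+1 (Y n.+1 x - Y n x) + (Y n.+1 (Y n x) - Y n (Y n x)).
    by rewrite (linB (Y_lin _)) addrA subrK.
  apply: (le_trans (ler_normD _ _)).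
  have h1 := Y_le n.+1 (Y n.+1 x - Y n x).
  have h2 := IH x; have h3 := IH (Y n x); have h4 := Y_le n x.
  have h5 : 0 <= rho ^+ n by rewrite exprn_ge0.
  rewrite exprS; nra.
have Y_dist n k x : `|Y (n + k)%N x - Y n x| <= rho ^+ n * (1 - rho)^-1 * `|x|.
  suff : `|Y (n + k)%N x - Y n x| <= rho ^+ n * (1 - rho)^-1 * (1 - rho ^+ k) * `|x|.
    move/le_trans; apply; rewrite ler_wpM2r// ler_piMr//.
      by rewrite mulr_ge0 ?exprn_ge0// invr_ge0 subr_ge0 ltW.
    by rewrite lerBlDr lerDl exprn_ge0.
  elim: k => [|k IH]; first by rewrite addn0 subrr normr0 expr0 subrr mulr0 mul0r.
  rewrite addnS -(subrK (Y (n + k)%N x) (Y (n + k).+1 x)) -addrA.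
  apply: (le_trans (ler_normD _ _)).
  apply: (le_trans (lerD (Y_diff _ _) IH)); rewrite -mulrDl ler_wpM2r//.
  rewrite exprD exprS le_eqVlt; apply/orP; left; apply/eqP; field.
  by rewrite subr_eq0 gt_eqF.
have geo : (fun n => rho ^+ n) @ \oo --> (0 : R).
  by apply: cvg_expr; rewrite ger0_norm.
pose Z x := limn (fun n => Y n x).
have YZ x : (fun n => Y n x) @ \oo --> Z x.
  apply: (@cauchy_sq_cvg _ _ _ (fun n => (rho ^+ n * (1 - rho)^-1 * `|x|) ^+ 2)).
    move=> m n nm; rewrite ler_sqr ?nnegrE ?mulr_ge0 ?exprn_ge0//.
    by have := Y_dist n (m - n)%N x; rewrite subnKC.
  have l : (fun n => rho ^+ n * (1 - rho)^-1 * `|x|) @ \oo --> (0 : R).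
    rewrite -[0](mul0r `|x|); apply: cvgM; last exact: cvg_cst.
    rewrite -[0](mul0r (1 - rho)^-1); apply: cvgM => //; exact: cvg_cst.
  by rewrite -[0](mulr0 0); exact: (cvgM l l).
have Z_lin : linear Z.
  move=> a x y; apply: (cvg_unique _ (YZ (a *: x + y))) => //.
  rewrite (_ : (fun n => _) = (fun n => a *: Y n x + Y n y)); last first.
    by apply/funext => n; exact: Y_lin.
  by apply: cvgD => //; exact: cvgZr.
have Z_sym : self_adjoint Z.
  move=> x y.
  have l1 : (fun n => '<Y n x, y>) @ \oo --> '<Z x, y>.
    by apply: inner_cvg => //; exact: cvg_cst.
  have l2 : (fun n => '<x, Y n y>) @ \oo --> '<x, Z y>.
    by apply: inner_cvg => //; exact: cvg_cst.
  have e : (fun n => '<x, Y n y>) = (fun n => '<Y n x, y>).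
    by apply/funext => n; rewrite Y_sym.
  by rewrite e in l2; exact: (cvg_unique _ l1 l2).
have Z_le x : `|Z x| <= rho * `|x|.
  by apply: (cvg_le_lim _ (fun n => Y_le n x) (cvg_norm (YZ x)) (cvg_cst _)).
have ZE x : Z x = 2^-1 *: (T x + Z (Z x)).
  have YY : (fun n => Y n (Y n x)) @ \oo --> Z (Z x).
    rewrite (_ : (fun n => _) = (fun n => Y n (Y n x - Z x) + Y n (Z x))); last first.
      by apply/funext => n; rewrite -(linD (Y_lin n)) subrK.
    rewrite -[X in _ --> X]add0r; apply: cvgD => //.
    apply: norm_cvg0; apply: (squeeze_cvgr _ (cvg_cst 0)); last first.
      rewrite -(mulr0 rho); apply: cvgM; first exact: cvg_cst.
      by have := cvg_norm (cvgB (YZ x) (cvg_cst (Z x))); rewrite subrr normr0; exact.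
    by apply: nearW => n; rewrite normr_ge0 Y_le.
  have l1 : (fun n => Y n.+1 x) @ \oo --> Z x.
    by have := YZ x; rewrite -(cvg_shiftS (fun n => Y n x)).
  have l2 : (fun n => Y n.+1 x) @ \oo --> 2^-1 *: (T x + Z (Z x)).
    by apply: cvgZr; apply: cvgD => //; exact: cvg_cst.
  exact: (cvg_unique _ l1 l2).
pose g := Num.sqrt c.
have gE : g ^+ 2 = c by rewrite sqr_sqrtr// ltW.
have g_ge0 : 0 <= g by exact: sqrtr_ge0.
exists (fun x => g *: (x - Z x)); split.
  split.
  - split.
      by move=> a x y; apply: inner_ext => z;
        rewrite (linD Z_lin) (linZ Z_lin) !innerE; ring.
    exists (g * (1 + rho)) => x; rewrite normrZ ger0_norm// -mulrA ler_wpM2l//.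
    by rewrite mulrDl mul1r (le_trans (ler_normB _ _))// lerD2l.
  - by move=> x y; rewrite !innerE Z_sym.
  - move=> x; rewrite scale0r inner0l innerZl innerDl innerNl mulr_ge0// subr_ge0
    inner_norm.
    apply: (le_trans (cauchy_schwarz _ _)); rewrite expr2 ler_wpM2r//.
    by rewrite (le_trans (Z_le _))// ler_piMl// ltW.
apply/funext => x /=; rewrite (linZ Z_lin) (linB Z_lin).
apply: inner_ext => z; have := congr1 (fun t => 2 * c * '<t, z>) (ZE x).
rewrite /T /= !innerE -!gE.
have gg : g ^+ 2 * (g ^+ 2)^-1 = 1 by rewrite gE mulfV.
move=> h.
have : '<U x, z> = g ^+ 2 * (g ^+ 2)^-1 * '<U x, z> by rewrite gg mul1r.
move: h; lra.
Qed.

Lemma sqrtopP (alpha : R) (U : H -> H) : 0 < alpha -> posop alpha U ->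
  posop 0 (sqrtop U) /\ forall x, sqrtop U (sqrtop U x) = U x.
Proof.
move=> alpha_gt0 U_pos.
have [S0 SS] := @xgetPex _ (fun=> 0) [set S | posop 0 S /\ S \o S = U]
  (posop_sqrt_exists alpha_gt0 U_pos).
by split => // x; rewrite -[RHS](congr1 (fun f => f x) SS).
Qed.

End SquareRoot.

(** * Weak limits along ultrafilters *)

Section WeakLimits.
Variables (R : realType) (H : hilbertType R).
Implicit Types (F : set_system nat) (u : nat -> H) (x y : H).

Lemma bounded_ultra_cvg F (UF : UltraFilter F) (f : nat -> R) (M : R) :
  (forall n, `|f n| <= M) -> exists l : R, f @ F --> l.
Proof.
move=> fM.
have [|l [_ fl]] := @segment_compact R (- M) M (f @ F) _.
  by apply: nearW => n; rewrite /= in_itv/= -ler_norml.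
exists l; apply/cvgrPdist_lt => e e0.
have [//|nF] := in_ultra_setVsetC [set n | `|l - f n| < e] UF.
have [|t [nt]] := fl (~` ball l e) (ball l e) nF; first exact: nbhsx_ballx.
by [].
Qed.

(** If f left a neighbourhood of l infinitely often, some ultrafilter finer than
    [\oo] would contain the set of these times. *)
Lemma ultra_cvg (f : nat -> R) (l : R) :
  (forall F, UltraFilter F -> \oo `<=` F -> f @ F --> l) -> f @ \oo --> l.
Proof.
move=> fl; apply/cvgrPdist_lt => e e0; apply: contrapT => nS.
set S := [set n | `|l - f n| < e] in nS.
have FF : ProperFilter (within (~` S) \oo).
  apply: Build_ProperFilter_ex.
  move=> B FB; apply: contrapT => nB; apply: nS; move: FB.
  apply: (@filterS _ \oo) => n h; apply: contrapT => nSn.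
  by apply: nB; exists n; exact: h.
have [F [UF FS]] := ultraFilterLemma FF.
have oF : \oo `<=` F.
  by move=> A oA; apply: FS; move: oA; apply: (@filterS _ \oo) => n An _.
have FnS : F (~` S) by apply: FS; apply: (@nearW _ \oo).
have FSS : F S by have /cvgrPdist_lt := fl F UF oF; exact.
have FS0 : F (S `&` ~` S) by exact: filterI.
by have [n []] := filter_ex FS0.
Qed.

(** Weak compactness without extraction of subsequences: the limits of the
    <u n, y> along F define a bounded functional of y, represented by Riesz. *)
Lemma weak_ultra_limit F (UF : UltraFilter F) u M : (forall n, `|u n| <= M) ->
  exists x, forall y, (fun n => '<u n, y>) @ F --> '<x, y>.
Proof.
move=> uM.
have M_ge0 : 0 <= M by exact: le_trans (uM 0%N).
have cvg_y y : exists l : R, (fun n => '<u n, y>) @ F --> l.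
  apply: (@bounded_ultra_cvg _ _ _ (M * `|y|)) => n.
  by rewrite (le_trans (abs_inner_le _ _))// ler_wpM2r.
have [f fP] := choice cvg_y.
have [a y y'||x fx] := @riesz _ H f M.
- have h : (fun n => '<u n, a *: y + y'>) @ F --> a * f y + f y'.
    rewrite (_ : (fun n => _) = (fun n => a * '<u n, y> + '<u n, y'>)); last first.
      by apply/funext => n; rewrite innerDr innerZr.
    by apply: cvgD => //; apply: cvgM => //; exact: cvg_cst.
  exact: (cvg_unique _ (fP _) h).
- move=> y; have h : (fun n => `|'<u n, y>|) @ F --> `|f y| by exact: cvg_norm.
  have h' : (fun _ : nat => M * `|y|) @ F --> M * `|y| by exact: cvg_cst.
  apply: (cvg_le_lim _ _ h h') => n.
  by rewrite (le_trans (abs_inner_le _ _))// ler_wpM2r.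
by exists x => y; rewrite -fx.
Qed.

Lemma weak_strong_inner F (FF : Filter F) u x a b M :
  (forall n, `|u n| <= M) -> (forall y, (fun n => '<u n, y>) @ F --> '<x, y>) ->
  a @ F --> b -> (fun n => '<u n, a n>) @ F --> '<x, b>.
Proof.
move=> uM ux ab.
rewrite (_ : (fun n => _) = (fun n => '<u n, a n - b> + '<u n, b>)); last first.
  by apply/funext => n; rewrite -innerDr subrK.
rewrite -[X in _ --> X]add0r; apply: cvgD => //.
apply: norm_cvg0; apply: (squeeze_cvgr _ (cvg_cst 0)); last first.
  rewrite -(mulr0 M); apply: cvgM; first exact: cvg_cst.
  by have := cvg_norm (cvgB ab (cvg_cst b)); rewrite subrr normr0; exact.
apply: nearW => n; rewrite normr_ge0 (le_trans (abs_inner_le _ _))//.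
by rewrite ler_wpM2r.
Qed.

(** For n <= m the operator W n - W m lies between 0 and M, so [sqrnorm_le_form]
    bounds |W n x - W m x|^2 by M times the difference of the convergent real
    sequence <W n x, x>. *)
Lemma decreasing_operators_cvg (W : nat -> H -> H) (M : R) : 0 <= M ->
  (forall n, linear (W n)) -> (forall n, self_adjoint (W n)) ->
  (forall n x, 0 <= '<W n x, x> <= M * `|x| ^+ 2) ->
  (forall n, loewner_ge (W n) (W n.+1)) ->
  forall x, cvgn (fun n => W n x).
Proof.
move=> M_ge0 W_lin W_sym W_bd W_decr x.
have W_le n m y : (n <= m)%N -> '<W m y, y> <= '<W n y, y>.
  elim: m => [|m IH]; first by rewrite leqn0 => /eqP ->.
  rewrite leq_eqVlt => /orP[/eqP -> //|]; rewrite ltnS => /IH.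
  exact: le_trans (W_decr _ _).
pose t n := '<W n x, x>.
have t_cvg : cvgn t.
  apply: nonincreasing_is_cvgn; first by move=> n m nm; exact: W_le.
  by exists 0 => _ [n _ <-]; have /andP[] := W_bd n x.
have t_ge n : limn t <= t n.
  by apply: nonincreasing_cvgn_ge => // a b ab; exact: W_le.
apply: (@cauchy_sq_cvg _ _ _ (fun n => M * (t n - limn t))).
  move=> m n nm; pose T y := W n y - W m y.
  rewrite -normrN opprB -/(T x).
  have TE y : '<T y, y> = '<W n y, y> - '<W m y, y> by rewrite innerDl innerNl.
  apply: (@le_trans _ _ (M * '<T x, x>)).
    apply: sqrnorm_le_form.
    - by move=> a y z; apply: inner_ext => w; rewrite /T (W_lin n) (W_lin m) !innerE;
      ring.
    - by move=> y z; rewrite !innerE (W_sym n) (W_sym m).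
    - by move=> y; rewrite TE subr_ge0 W_le.
    - move=> y; rewrite TE; have /andP[_ h1] := W_bd n y.
      have /andP[h2 _] := W_bd m y; lra.
  rewrite TE; have := t_ge m; rewrite -/(t n) -/(t m).
  by move=> h; rewrite ler_wpM2l// lerD2l lerN2.
rewrite -(mulr0 M) -(subrr (limn t)); apply: cvgM; first exact: cvg_cst.
by apply: cvgB => //; exact: cvg_cst.
Qed.

End WeakLimits.

(** * Summable errors and quasi-Fejer sequences *)

Section RealSequences.
Variable R : realType.
Implicit Types s r e w : nat -> R.

(** For nonnegative sequences, bounded partial sums are summability, in a form
    stable under sums and comparison without limits. *)
Definition summable_seq e := exists M, forall n, \sum_(k < n) e k <= M.

Lemma summable_seq_is_cvg e : (forall n, 0 <= e n) -> summable_seq e ->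
  cvgn (fun n => \sum_(k < n) e k).
Proof.
move=> e_ge0 [M eM]; apply: nondecreasing_is_cvgn.
  by apply/nondecreasing_seqP => n; rewrite big_ord_recr lerDl.
by exists M => _ [n _ <-]; exact: eM.
Qed.

(** Subtracting the partial sums of e makes s nonincreasing. *)
Lemma quasi_fejer_cvg s e : (forall n, 0 <= s n) -> (forall n, 0 <= e n) ->
  summable_seq e -> (forall n, s n.+1 <= s n + e n) -> cvgn s.
Proof.
move=> s_ge0 e_ge0 e_sum se; have E_cvg := summable_seq_is_cvg e_ge0 e_sum.
have [M eM] := e_sum; pose E n := \sum_(k < n) e k.
have ES n : E n.+1 = E n + e n by rewrite /E big_ord_recr.
have d_cvg : cvgn (fun n => s n - E n).
  apply: nonincreasing_is_cvgn.
    by apply/nonincreasing_seqP => n; rewrite ES; have := se n; lra.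
  exists (- M) => _ [n _ <-] /=.
  by have := eM n; have := s_ge0 n; rewrite -/(E n); lra.
rewrite (_ : s = (fun n => (s n - E n) + E n)); first exact: is_cvgD.
by apply/funext => n; rewrite subrK.
Qed.

Lemma summable_seq_cvg0 e : (forall n, 0 <= e n) -> summable_seq e ->
  e @ \oo --> 0.
Proof.
move=> e_ge0 e_sum; pose E n := \sum_(k < n) e k.
have E_cvg : cvgn E by exact: summable_seq_is_cvg.
rewrite (_ : e = (fun n => E n.+1 - E n)); last first.
  by apply/funext => n; rewrite /E big_ord_recr /= addrAC subrr add0r.
rewrite -(subrr (limn E)); apply: cvgB => //.
by have := E_cvg; rewrite -(cvg_shiftS E).
Qed.

(** The gain w n is at most (s n - r n) (s n + r n), and s n - r n is at most s
    n - s n.+1 + e n, which tends to 0. *)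
Lemma quasi_fejer_decrease s r w e : (forall n, 0 <= s n) -> (forall n, 0 <= r n) ->
  (forall n, 0 <= w n) -> (forall n, 0 <= e n) -> summable_seq e ->
  (forall n, s n.+1 <= r n + e n) -> (forall n, r n ^+ 2 + w n <= s n ^+ 2) ->
  cvgn s /\ w @ \oo --> 0.
Proof.
move=> s_ge0 r_ge0 w_ge0 e_ge0 e_sum sr rw.
have rs n : r n <= s n.
  by rewrite -ler_sqr ?nnegrE// (le_trans _ (rw n))// lerDl.
have s_cvg : cvgn s.
  apply: (quasi_fejer_cvg s_ge0 e_ge0 e_sum) => n.
  by rewrite (le_trans (sr n))// lerD2r.
split => //.
have l : (fun n => (s n - s n.+1 + e n) * (2 * s n)) @ \oo --> (limn s - limn s + 0) *
  (2 * limn s).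
  apply: cvgM; last by apply: cvgM => //; exact: cvg_cst.
  apply: cvgD; last exact: summable_seq_cvg0.
  by apply: cvgB => //; have := s_cvg; rewrite -(cvg_shiftS s).
rewrite subrr addr0 mul0r in l.
apply: (squeeze_cvgr _ (cvg_cst 0) l); apply: nearW => n; rewrite w_ge0/=.
have := rw n; have := sr n; have := rs n; have := r_ge0 n; have := e_ge0 n.
move: (s n) (r n) (e n) (s n.+1) (w n) => a b c d f; nra.
Qed.

End RealSequences.

Lemma cvg0_of_sqr (R : realType) (V : normedModType R) (u : nat -> V) (t : nat -> R) :
  (forall n, `|u n| ^+ 2 <= t n) -> t @ \oo --> 0 -> u @ \oo --> 0.
Proof.
move=> ut t0; apply/cvgr0Pnorm_lt => e e0.
have /cvgr0Pnorm_lt /(_ (e ^+ 2)) := t0; rewrite exprn_gt0// => /(_ isT).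
apply: filterS => n h; rewrite -ltr_sqr ?nnegrE ?(ltW e0)//.
by apply: le_lt_trans h; exact: le_trans (ut n) (ler_norm _).
Qed.

Lemma cvgn_bounded (R : realType) (s : nat -> R) : cvgn s ->
  exists M, forall n, s n <= M.
Proof.
move=> /cvg_seq_bounded /pinfty_ex_gt0 [M _ h]; exists M => n.
by apply: (le_trans (ler_norm _)); exact: h.
Qed.

Section Summability.
Variable R : realType.

Lemma summable_seqD (e f : nat -> R) : summable_seq e -> summable_seq f ->
  summable_seq (fun n => e n + f n).
Proof.
move=> [M eM] [M' fM]; exists (M + M') => n.
by rewrite big_split lerD.
Qed.

Lemma summable_seqZ (c : R) (e : nat -> R) : 0 <= c -> summable_seq e ->
  summable_seq (fun n => c * e n).
Proof.
by move=> c0 [M eM]; exists (c * M) => n; rewrite -mulr_sumr ler_wpM2l.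
Qed.

Lemma summable_seq_sum (I : finType) (e : I -> nat -> R) :
  (forall i, summable_seq (e i)) -> summable_seq (fun n => \sum_i e i n).
Proof.
move=> /choice[M eM]; exists (\sum_i M i) => n.
by rewrite exchange_big /=; apply: ler_sum => i _; exact: eM.
Qed.

Lemma le_summable_seq (e f : nat -> R) : (forall n, e n <= f n) ->
  summable_seq f -> summable_seq e.
Proof.
by move=> ef [M fM]; exists M => n; rewrite (le_trans _ (fM n))// ler_sum.
Qed.

Lemma absolutely_summableP (H : hilbertType R) (a : nat -> H) :
  absolutely_summable a -> summable_seq (fun n => `|a n|).
Proof.
move=> /cvgn_bounded[M hM]; exists M => n.
by have : series (fun k => `|a k|) n <= M := hM n; rewrite seriesEord.
Qed.

End Summability.

(** * Variable metric forward-backward iterations *)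

Section VariableMetricForwardBackward.
Variables (R : realType) (K : hilbertType R).
Variables (A : K -> set K) (B : K -> K) (beta : R).
Hypotheses (A_max : maximally_monotone A) (beta_gt0 : 0 < beta)
  (B_coco : cocoercive beta B).
Variables (W : nat -> K -> K) (rho M : R).
Hypotheses (W_lin : forall n, linear (W n))
  (W_sym : forall n, self_adjoint (W n))
  (W_ge : forall n x, rho * `|x| ^+ 2 <= '<W n x, x>)
  (W_le : forall n x, '<W n x, x> <= M * `|x| ^+ 2)
  (W_decr : forall n, loewner_ge (W n) (W n.+1)).
Hypotheses (rho_gt0 : 0 < rho) (rho_beta : 1 < 2 * beta * rho) (M_ge0 : 0 <= M).
Variables (lambda : nat -> R) (eps : R).
Hypotheses (eps_gt0 : 0 < eps) (lambda_itv : forall n, eps <= lambda n <= 1).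
Variables (k kh e : nat -> K).
Hypotheses (e_sum : summable_seq (fun n => `|e n|))
  (kS : forall n, k n.+1 = k n + lambda n *: (kh n - k n) + e n)
  (khP : forall n, A (kh n) (W n (k n - kh n) - B (k n))).

Let N n x := '<W n x, x>.
Let c := (2 * beta * rho - 1) / (rho + 2 * beta).

Let W_ge0 n x : 0 <= '<W n x, x>.
Proof. by apply: le_trans (W_ge n x); rewrite mulr_ge0 ?sqr_ge0// ltW. Qed.

Let den_gt0 : 0 < rho + 2 * beta.
Proof. by rewrite addr_gt0// mulr_gt0. Qed.

Let c_gt0 : 0 < c.
Proof. by rewrite divr_gt0// subr_gt0. Qed.

(** Monotonicity between kh n and z bounds <kh n - z, W n (k n - kh n)> from
    below by <kh n - z, D>, where D = B (k n) - B z, and cocoercivity bounds the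
    latter by beta |D|^2 - |k n - kh n| |D|. The remaining form rho |g|^2 - 2
    |g| |D| + 2 beta |D|^2 is positive definite since 2 beta rho > 1, and c
    bounds its smallest eigenvalue from below. *)
Lemma forward_backward_decrease z n : A z (- B z) ->
  N n (kh n - z) <=
  N n (k n - z) - c * (`|k n - kh n| ^+ 2 + `|B (k n) - B z| ^+ 2).
Proof.
move=> Az; set g := k n - kh n; set d := kh n - z; set D := B (k n) - B z.
have xE : k n - z = d + g by rewrite /d /g [RHS]addrC addrA subrK.
have [A_mon _] := A_max.
have h1 := A_mon _ _ _ _ (khP n) Az.
have h1' : 0 <= '<d, W n g> - '<d, D>.
  by rewrite -innerNr -innerDr; move: h1; rewrite -/d -/g /D !innerE; lra.
have h2 : beta * `|D| ^+ 2 <= '<d, D> + '<g, D>.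
  by have := B_coco (k n) z; rewrite xE innerDl.
have h3 := cauchy_schwarz g D.
have h4 := W_ge n g.
have -> : N n (k n - z) = N n d + 2 * '<d, W n g> + N n g.
  by rewrite xE /N formD// (W_sym n d g).
have cE : c * (rho + 2 * beta) = 2 * beta * rho - 1.
  by rewrite /c divfK// gt_eqF.
have c_lt : c < rho.
  by rewrite /c ltr_pdivrMr//; nra.
have h5 : 2 * (`|g| * `|D|) <= (rho - c) * `|g| ^+ 2 + (2 * beta - c) * `|D| ^+ 2.
  apply: weighted_young; first by rewrite subr_gt0.
  have := sqr_ge0 c; move: cE; move: c => c' cE; nra.
move: h4; rewrite -/(N n g); move: (N n g) (N n d) => ng nd h4.
move: c cE c_lt h5 => c' _ _ h5; lra.
Qed.

Lemma forward_backward_fejer z : A z (- B z) ->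
  [/\ cvgn (fun n => Num.sqrt (N n (k n - z))),
      (fun n => k n - kh n) @ \oo --> 0,
      (fun n => B (k n)) @ \oo --> B z
    & exists M', forall n, `|k n| <= M'].
Proof.
move=> Az.
(* [w n] is the gain of the relaxed step, [r n] the distance after it, measured
   in the metric n, and the metric n.+1 is smaller. *)
pose w n := eps * c * (`|k n - kh n| ^+ 2 + `|B (k n) - B z| ^+ 2).
pose s n := Num.sqrt (N n (k n - z)).
pose r n := Num.sqrt (N n (k n + lambda n *: (kh n - k n) - z)).
have w_ge n : 0 <= w n by rewrite mulr_ge0 ?addr_ge0 ?sqr_ge0// mulr_ge0 ?ltW.
have [s_cvg w0] : cvgn s /\ w @ \oo --> 0.
  apply: (@quasi_fejer_decrease _ s r w (fun n => Num.sqrt M * `|e n|)) => //.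
  - by move=> n; exact: sqrtr_ge0.
  - by move=> n; exact: sqrtr_ge0.
  - have [E hE] := e_sum; exists (Num.sqrt M * E) => n.
    by rewrite -mulr_sumr ler_wpM2l ?sqrtr_ge0.
  - move=> n; rewrite /s /r kS.
    apply: (@le_trans _ _ (Num.sqrt (N n (k n + lambda n *: (kh n - k n) + e n - z)))).
      by rewrite ler_wsqrtr// W_decr.
    rewrite addrAC; apply: (le_trans (sqrt_form_triangle _ _ (W_lin n) (W_sym n) (W_ge0
      n))).
    rewrite lerD2l -[X in _ <= _ * X]ger0_norm// -sqrtr_sqr -sqrtrM//.
    exact: ler_wsqrtr.
  - move=> n; rewrite /r /s !sqr_sqrtr ?W_ge0//.
    have := forward_backward_decrease n Az.
    have /andP[l1 l2] := lambda_itv n.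
    have := W_ge0 n (k n - kh n); rewrite /w.
    set g := k n - kh n; set S := _ + _ ^+ 2.
    have -> : k n + lambda n *: (kh n - k n) - z = (k n - z) - lambda n *: g.
      by apply: inner_ext => y; rewrite !innerE; ring.
    have -> : kh n - z = (k n - z) - g.
      by apply: inner_ext => y; rewrite !innerE; ring.
    have S_ge0 : 0 <= c * S by rewrite mulr_ge0 ?(ltW c_gt0)// /S addr_ge0 ?sqr_ge0.
    clearbody S; clearbody g; rewrite /N formBZ// formB// -(mulrA eps).
    move: (c * S) ('<W n g, g>) '<W n (k n - z), k n - z> '<W n (k n - z), g> S_ge0.
    move=> a1 a2 a3 a4 a1_ge0 a2_ge0 h.
    have l_ge0 : 0 <= lambda n by rewrite (le_trans _ l1)// ltW.
    have p1 : 0 <= (lambda n - eps) * a1 by rewrite mulr_ge0 ?subr_ge0.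
    have p2 : 0 <= lambda n * (2 * a4 - a2 - a1) by rewrite mulr_ge0//; lra.
    have p3 : 0 <= lambda n * (1 - lambda n) * a2.
      by rewrite mulr_ge0// mulr_ge0// subr_ge0.
    lra.
have wE n : `|k n - kh n| ^+ 2 + `|B (k n) - B z| ^+ 2 = (eps * c)^-1 * w n.
  by rewrite /w mulKf// mulf_neq0// gt_eqF.
have w0' : (fun n => (eps * c)^-1 * w n) @ \oo --> 0.
  by rewrite -(mulr0 (eps * c)^-1); apply: cvgM => //; exact: cvg_cst.
split => //.
- by apply: cvg0_of_sqr w0' => n; rewrite -wE lerDl sqr_ge0.
- have : (fun n => B (k n) - B z) @ \oo --> 0.
    by apply: cvg0_of_sqr w0' => n; rewrite -wE lerDr sqr_ge0.
  by move/subr_cvg0.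
- have [S hS] := cvgn_bounded s_cvg.
  exists (`|z| + Num.sqrt (rho^-1 * S ^+ 2)) => n.
  rewrite -{1}(subrK z (k n)) addrC (le_trans (ler_normD _ _))// lerD2l.
  rewrite -[leLHS]ger0_norm// -sqrtr_sqr ler_wsqrtr// ler_pdivlMl//.
  apply: (le_trans (W_ge n _)); rewrite -[leLHS](sqr_sqrtr (W_ge0 n _)).
  by rewrite ler_sqr ?nnegrE ?sqrtr_ge0 ?hS// (le_trans _ (hS n))// sqrtr_ge0.
Qed.

(** Strong convergence of B (k n) to B z and weak convergence of k n make the
    cocoercivity inequality between k n and x pass to the limit, so B x = B z.
    The monotonicity inequalities at kh n then pass to the limit as well: kh n
    has the weak limit of k n, and W n (k n - kh n) - B (k n) converges
    strongly. *)
Lemma forward_backward_demiclosed z F x : ProperFilter F -> \oo `<=` F ->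
  A z (- B z) ->
  (forall y, (fun n => '<k n, y>) @ F --> '<x, y>) -> A x (- B x).
Proof.
move=> FF oF Az kx.
have [_ g0 Bk [M' kM]] := forward_backward_fejer Az.
have sub (V : topologicalType) (u : nat -> V) (l : V) : u @ \oo --> l -> u @ F --> l.
  by move=> ul S Sl; apply: oF; exact: ul.
have BF := sub _ _ _ Bk; have gF := sub _ _ _ g0.
have BE : B z = B x.
  apply/subr0_eq/normr0_eq0/eqP; rewrite -sqrf_eq0 eq_le sqr_ge0 andbT.
  rewrite -(pmulr_rle0 _ beta_gt0).
  have d1 : (fun n => B (k n) - B x) @ F --> B z - B x.
    by apply: cvgB => //; exact: cvg_cst.
  have l1 : (fun n => beta * `|B (k n) - B x| ^+ 2) @ F --> beta * `|B z - B x| ^+ 2.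
    apply: cvgM; first exact: cvg_cst.
    by apply: cvgM; exact: cvg_norm.
  have l2 : (fun n => '<k n - x, B (k n) - B x>) @ F --> 0.
    rewrite (_ : (fun n => _) = (fun n => '<k n, B (k n) - B x> - '<x, B (k n) - B
      x>)); last first.
      by apply/funext => n; rewrite innerDl innerNl.
    rewrite -(subrr '<x, B z - B x>); apply: cvgB.
      exact: weak_strong_inner kM kx d1.
    by apply: inner_cvg => //; exact: cvg_cst.
  by apply: (cvg_le_lim _ _ l1 l2) => n; exact: B_coco.
have /maximally_monotoneP[A_mon A_crit] := A_max.
apply: A_crit => y v Ayv; rewrite -BE.
have Wg0 : (fun n => W n (k n - kh n)) @ F --> 0.
  apply: sub; apply: (@cvg0_of_sqr _ _ _ (fun n =>
    M ^+ 2 * (`|k n - kh n| * `|k n - kh n|))).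
    move=> n; apply: (le_trans (sqrnorm_le_form _ (W_lin n) (W_sym n) (W_ge0 n) (W_le
      n))).
    by rewrite -expr2 expr2 -mulrA ler_wpM2l.
  rewrite -(mulr0 (M ^+ 2)); apply: cvgM; first exact: cvg_cst.
  have h : (fun n => `|k n - kh n|) @ \oo --> (0 : R).
    by rewrite -(normr0 K); exact: cvg_norm.
  by rewrite -(mulr0 0); apply: cvgM.
have d1 : (fun n => W n (k n - kh n) - B (k n) - v) @ F --> - B z - v.
  apply: cvgB; last exact: cvg_cst.
  by rewrite -[X in _ --> X]add0r; apply: cvgB.
have l : (fun n => '<kh n - y, W n (k n - kh n) - B (k n) - v>) @ F --> '<x - y, - B z
  - v>.
  pose a n := W n (k n - kh n) - B (k n) - v.
  rewrite (_ : (fun n => _) = (fun n => '<k n, a n> - '<(k n - kh n) + y, a n>));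
    last first.
    by apply/funext => n; rewrite -/(a n) !innerE; ring.
  rewrite innerDl innerNl; apply: cvgB; first exact: weak_strong_inner kM kx d1.
  apply: inner_cvg => //; rewrite -[X in _ --> X]add0r.
  by apply: cvgD => //; exact: cvg_cst.
have l0 : (fun _ : nat => (0 : R)) @ F --> (0 : R) by exact: cvg_cst.
by apply: (cvg_le_lim _ _ l0 l) => n; exact: A_mon.
Qed.

(** Let x and x' be the weak limits along two ultrafilters. Both are zeros, so
    the difference of the squared W n-distances from k n to them converges; it
    is affine in k n, and therefore <k n, W n (x - x')> converges. As W n
    (x - x') converges strongly, its limit Wy satisfies <x, Wy> = <x', Wy>, and
    W n >= rho forces x = x'. *)
Theorem forward_backward_weak_cvg : (exists z, A z (- B z)) ->
  exists x, [/\ A x (- B x), weak_cvg k x & (fun n => B (k n)) @ \oo --> B x].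
Proof.
move=> [z Az].
have [_ _ _ [M' kM]] := forward_backward_fejer Az.
have [F0 [UF0 oF0]] := ultraFilterLemma (_ : ProperFilter (\oo : set_system nat)).
have [x kx] := weak_ultra_limit UF0 kM.
have Ax : A x (- B x) by exact: forward_backward_demiclosed oF0 Az kx.
exists x; split => //; last by have [] := forward_backward_fejer Ax.
move=> y0; apply: ultra_cvg => F UF oF.
have [x' kx'] := weak_ultra_limit UF kM.
suff -> : x = x' by exact: kx'.
have Ax' : A x' (- B x') by exact: forward_backward_demiclosed oF Az kx'.
pose y := x - x'.
have W_cvg u : cvgn (fun n => W n u).
  apply: (decreasing_operators_cvg M_ge0) => // n v.
  by rewrite W_ge0 W_le.
pose Wy := limn (fun n => W n y).
have WyP : (fun n => W n y) @ \oo --> Wy by exact: W_cvg.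
have N_cvg u : A u (- B u) -> cvgn (fun n => N n (k n - u)).
  move=> Au; have [h _ _ _] := forward_backward_fejer Au.
  pose s n := Num.sqrt (N n (k n - u)).
  rewrite (_ : (fun n => _) = (fun n => s n * s n)).
    exact: is_cvgM.
  by apply/funext => n; rewrite -expr2 sqr_sqrtr// W_ge0.
have NW_cvg u : cvgn (fun n => N n u).
  by apply/cvg_ex; eexists; apply: inner_cvg; [exact: W_cvg|exact: cvg_cst].
have /cvg_ex[l kWl] : cvgn (fun n => '<k n, W n y>).
  rewrite (_ : (fun n => _) = (fun n => 2^-1 * (N n (k n - x') - N n (k n - x)
     + (N n x - N n x')))).
    apply: is_cvgM; first exact: is_cvg_cst.
    by apply: is_cvgD; apply: is_cvgB; auto.
  apply/funext => n; rewrite -W_sym /N !formB// innerDr innerNr.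
  by field.
have lim_eq F' u : UltraFilter F' -> \oo `<=` F' ->
    (forall v, (fun n => '<k n, v>) @ F' --> '<u, v>) -> '<u, Wy> = l.
  move=> UF' oF' ku.
  have WF' : (fun n => W n y) @ F' --> Wy by move=> S Sl; apply: oF'; exact: WyP.
  have h1 : (fun n => '<k n, W n y>) @ F' --> '<u, Wy>.
    exact: weak_strong_inner kM ku WF'.
  have h2 : (fun n => '<k n, W n y>) @ F' --> l by move=> S Sl; apply: oF'; exact: kWl.
  exact: (cvg_unique _ h1 h2).
have : '<y, Wy> = 0.
  by rewrite innerDl innerNl (lim_eq F0)// (lim_eq F)// subrr.
have : rho * `|y| ^+ 2 <= '<y, Wy>.
  have l1 : (fun n => '<y, W n y>) @ \oo --> '<y, Wy>.
    by apply: inner_cvg => //; exact: cvg_cst.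
  have l0 : (fun _ : nat => rho * `|y| ^+ 2) @ \oo --> rho * `|y| ^+ 2 by exact: cvg_cst.
  by apply: (cvg_le_lim _ _ l0 l1) => n; rewrite innerC.
move=> h1 h2; rewrite h2 -inner_norm pmulr_rle0// in h1.
exact/subr0_eq/(inner_le0 h1).
Qed.

End VariableMetricForwardBackward.

(** * The space of primal-dual vectors *)

Lemma big_option (V : nmodType) (I : finType) (F : option I -> V) :
  \sum_o F o = F None + \sum_i F (Some i).
Proof.
rewrite (bigD1 None)//=; congr (_ + _).
rewrite (reindex_omap Some id) /=; last by case.
by apply: eq_bigl => i; rewrite eqxx.
Qed.

Section BlockSpace.
Context {R : realType} {m : nat} {H : hilbertType R} {G : 'I_m -> hilbertType R}.

(** The index [None] is that of the primal space. *)
Definition block_family (o : option 'I_m) : hilbertType R :=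
  if o is Some i then G i else H.

Definition block : hilbertType R := dsum block_family.

Definition mkblock (x : H) (v : forall i, G i) : block :=
  fun o => match o return block_family o with None => x | Some i => v i end.

Definition primal (k : block) : H := k None.
Definition dual (k : block) i : G i := k (Some i).

Lemma block_ext (k l : block) :
  primal k = primal l -> (forall i, dual k i = dual l i) -> k = l.
Proof.
by move=> h0 hi; apply: functional_extensionality_dep => -[i|]; [exact: hi|exact: h0].
Qed.

Lemma block_innerE (k l : block) :
  '<k, l> = '<primal k, primal l> + \sum_i '<dual k i, dual l i>.
Proof. by rewrite dsum_innerE big_option. Qed.

Lemma primalD k l : primal (k + l) = primal k + primal l. Proof. by []. Qed.

Lemma primalB k l : primal (k - l) = primal k - primal l. Proof. by []. Qed.

Lemma primalZ (a : R) k : primal (a *: k) = a *: primal k. Proof. by []. Qed.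

Lemma dualD k l i : dual (k + l) i = dual k i + dual l i. Proof. by []. Qed.

Lemma dualB k l i : dual (k - l) i = dual k i - dual l i. Proof. by []. Qed.

Lemma dualZ (a : R) k i : dual (a *: k) i = a *: dual k i. Proof. by []. Qed.

Lemma sqrnorm_block (k : block) :
  `|k| ^+ 2 = `|primal k| ^+ 2 + \sum_i `|dual k i| ^+ 2.
Proof.
rewrite -inner_norm block_innerE inner_norm; congr (_ + _).
by apply: eq_bigr => i _; rewrite inner_norm.
Qed.

Lemma norm_block_le (k : block) : `|k| <= `|primal k| + \sum_i `|dual k i|.
Proof. by apply: (le_trans (dsum_norm_le_sum k)); rewrite big_option. Qed.

Lemma primal_norm_le (k : block) : `|primal k| <= `|k|.
Proof. exact: (dsum_coord_le k None). Qed.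

Lemma dual_norm_le (k : block) i : `|dual k i| <= `|k|.
Proof. exact: (dsum_coord_le k (Some i)). Qed.

End BlockSpace.

Arguments block {R m} H G.

Section BlockWeak.
Context {R : realType} {m : nat} {H : hilbertType R} {G : 'I_m -> hilbertType R}.
Implicit Types (k : nat -> block H G) (l : block H G).

Lemma weak_cvg_primal k l : weak_cvg k l ->
  weak_cvg (fun n => primal (k n)) (primal l).
Proof.
move=> kl w; have := kl (mkblock w (fun=> 0)).
have E (l' : block H G) : '<l', mkblock w (fun=> 0)> = '<primal l', w>.
  by rewrite block_innerE [X in _ + X]big1 ?addr0// => i _; exact: inner0r.
rewrite E (_ : (fun n => _) = (fun n => '<primal (k n), w>))//.
by apply/funext => n; rewrite E.
Qed.

Lemma weak_cvg_dual i k l : weak_cvg k l ->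
  weak_cvg (fun n => dual (k n) i) (dual l i).
Proof.
move=> kl w.
pose w' : forall j, G j := @dfwith _ (fun j => G j : Type) (fun j => 0) i w.
have := kl (mkblock 0 w').
have E (l' : block H G) : '<l', mkblock 0 w'> = '<dual l' i, w>.
  rewrite block_innerE [X in X + _](_ : _ = '<primal l', 0>)// inner0r add0r.
  rewrite (bigD1 i)//= big1 ?addr0; first by rewrite {2}/dual /= /w' dfwithin.
  move=> j ji; rewrite {2}/dual /= /w' dfwithout ?inner0r//.
  by rewrite eq_sym.
rewrite E (_ : (fun n => _) = (fun n => '<dual (k n) i, w>))//.
by apply/funext => n; rewrite E.
Qed.

End BlockWeak.

(** * The primal-dual metric *)

Section InverseOperator.
Variables (R : realType) (H : hilbertType R).

Definition inverse_op (U : H -> H) : H -> H :=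
  xget (fun=> 0) [set P : H -> H | cancel P U /\ cancel U P].

Lemma inverse_opP (U : H -> H) (alpha : R) : 0 < alpha -> posop alpha U ->
  let P := inverse_op U in
  [/\ cancel P U, cancel U P, linear P, self_adjoint P &
    forall x, 0 <= '<P x, x> <= alpha^-1 * `|x| ^+ 2].
Proof.
move=> alpha_gt0 U_pos P.
have [P' [PU UP P_lin P_sym P_bd]] := posop_inverse alpha_gt0 U_pos.
suff <- : P' = P by [].
have [PU' UP'] : cancel P U /\ cancel U P.
  by apply: (@xgetPex _ (fun=> 0) [set P : H -> H | cancel P U /\ cancel U P]); exists P'.
by apply/funext => x; rewrite -{1}(PU' x) UP.
Qed.

(** With a = U^-1 x and b = V^-1 x, expand 0 <= <U (a - b), a - b> and use
    <U b, b> <= <V b, b> = <x, b>. *)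
Lemma inverse_op_antitone (U V : H -> H) (alpha : R) : 0 < alpha ->
  posop alpha U -> posop alpha V -> loewner_ge V U ->
  loewner_ge (inverse_op U) (inverse_op V).
Proof.
move=> alpha_gt0 U_pos V_pos UV x.
have [PU _ _ _ _] := inverse_opP alpha_gt0 U_pos.
have [QV _ _ _ _] := inverse_opP alpha_gt0 V_pos.
have [[U_lin _] U_sym U_ge] := U_pos.
set a := inverse_op U x; set b := inverse_op V x.
have := U_ge (a - b); rewrite (formB _ _ U_lin U_sym) innerZl inner_norm.
have := UV b; rewrite PU QV (innerC x a) (innerC x b) => h1 h2.
have h3 : 0 <= alpha * `|a - b| ^+ 2 by rewrite mulr_ge0 ?sqr_ge0// ltW.
lra.
Qed.

(** With y = U^-1 x this reads |U y|^2 <= |U| <U y, y>. *)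
Lemma norm_le_inverse_form (U : H -> H) (alpha : R) x : 0 < alpha ->
  posop alpha U -> `|x| ^+ 2 <= opnorm U * '<inverse_op U x, x>.
Proof.
move=> alpha_gt0 U_pos.
have [PU UP P_lin P_sym P_bd] := inverse_opP alpha_gt0 U_pos.
have [U_bd U_sym U_ge] := U_pos.
have UF0 y : 0 <= '<U y, y>.
  by apply: le_trans (U_ge y); rewrite innerZl mulr_ge0 ?inner_ge0// ltW.
rewrite (innerC _ x); move: (PU x); move: (inverse_op U x) => y <- {x}.
apply: sqrnorm_le_form => //; first exact: U_bd.1.
move=> {}y; apply: (le_trans (cauchy_schwarz _ _)).
by rewrite expr2 mulrA ler_wpM2r// opnorm_ge.
Qed.

End InverseOperator.

(** Write x = S x' and w = T w', where S and T are the square roots of U and V;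
    then |x'|^2 = <U^-1 x, x> and |w'|^2 = <V^-1 w, w>. *)
Lemma coupling_le (R : realType) (H G : hilbertType R) (L : H -> G) (U : H -> H)
  (V : G -> G) (alpha : R) x w : 0 < alpha -> bounded_linear L ->
  posop alpha U -> posop alpha V ->
  '<L x, w> <= opnorm (sqrtop V \o L \o sqrtop U) *
    (Num.sqrt '<inverse_op U x, x> * Num.sqrt '<inverse_op V w, w>).
Proof.
move=> alpha_gt0 L_bd U_pos V_pos.
have [PU _ _ _ _] := inverse_opP alpha_gt0 U_pos.
have [QV _ _ _ _] := inverse_opP alpha_gt0 V_pos.
have [[S_bd S_sym _] SS] := sqrtopP alpha_gt0 U_pos.
have [[T_bd T_sym _] TT] := sqrtopP alpha_gt0 V_pos.
set S := sqrtop U in S_bd S_sym SS *; set T := sqrtop V in T_bd T_sym TT *.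
pose x' := S (inverse_op U x); pose w' := T (inverse_op V w).
have xE : x = S x' by rewrite /x' SS PU.
have wE : w = T w' by rewrite /w' TT QV.
have -> : '<inverse_op U x, x> = `|x'| ^+ 2.
  by rewrite -inner_norm /x' S_sym SS PU.
have -> : '<inverse_op V w, w> = `|w'| ^+ 2.
  by rewrite -inner_norm /w' T_sym TT QV.
rewrite !sqrtr_sqr !normr_id {1}wE -T_sym {1}xE.
apply: (le_trans (cauchy_schwarz _ _)); rewrite mulrA ler_wpM2r//.
have bd : bounded_linear (T \o L \o S).
  by apply: bounded_linear_comp => //; exact: bounded_linear_comp.
exact: (opnorm_ge x' bd).
Qed.

Lemma sum_cauchy_schwarz (R : realType) (I : finType) (s t : I -> R) :
  \sum_i s i * t i <= Num.sqrt (\sum_i s i ^+ 2) * Num.sqrt (\sum_i t i ^+ 2).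
Proof.
have s2 : 0 <= \sum_i s i ^+ 2 by apply: sumr_ge0 => i _; exact: sqr_ge0.
rewrite -sqrtrM// (le_trans (ler_norm _))// -sqrtr_sqr ler_wsqrtr//.
apply: discriminant_le => a.
rewrite (_ : _ + _ = \sum_i (s i + a * t i) ^+ 2).
  by apply: sumr_ge0 => i _; exact: sqr_ge0.
rewrite !mulr_sumr -!big_split /=; apply: eq_bigr => i _; ring.
Qed.

Section BlockMetric.
Context {R : realType} {m : nat} {H : hilbertType R} {G : 'I_m -> hilbertType R}.
Variables (L : forall i, H -> G i) (U : H -> H) (V : forall i, G i -> G i).
Arguments V i _ : clear implicits.
Variable alpha : R.
Hypotheses (alpha_gt0 : 0 < alpha) (L_bd : forall i, bounded_linear (L i))
  (U_pos : posop alpha U) (V_pos : forall i, posop alpha (V i)).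
Local Notation K := (block H G).

Definition block_metric (k : K) : K :=
  mkblock (inverse_op U (primal k) - \sum_i adjoint (L i) (dual k i))
    (fun i => inverse_op (V i) (dual k i) - L i (primal k)).

Lemma block_metric_linear : linear block_metric.
Proof.
have [_ _ P_lin _ _] := inverse_opP alpha_gt0 U_pos.
move=> a k l; apply: block_ext => [|i].
  rewrite primalD primalZ /= /primal /=; rewrite -/(primal _).
  rewrite P_lin scalerBr scaler_sumr.
  rewrite (eq_bigr (fun i => a *: adjoint (L i) (dual k i) + adjoint (L i) (dual l
    i))); last first.
    by move=> i _; rewrite -(adjoint_linear (L_bd i)).
  by rewrite big_split /= opprD addrACA.
have [_ _ Q_lin _ _] := inverse_opP alpha_gt0 (V_pos i).
rewrite dualD dualZ /= /dual /= -/(dual _ _).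
rewrite Q_lin (linD (L_bd i).1) (linZ (L_bd i).1) scalerBr opprD.
by rewrite addrACA.
Qed.

(** Written so that the symmetry in k and l is visible: the off-diagonal blocks
    of the metric are adjoint to each other. *)
Lemma block_metric_innerE (k l : K) : '<block_metric k, l> =
  '<inverse_op U (primal k), primal l>
  - \sum_i ('<L i (primal l), dual k i> + '<L i (primal k), dual l i>)
  + \sum_i '<inverse_op (V i) (dual k i), dual l i>.
Proof.
rewrite block_innerE /= innerDl innerNl inner_suml -!addrA; congr (_ + _).
rewrite big_split /= opprD -addrA; congr (_ + _).
  by congr (- _); apply: eq_bigr => i _; rewrite innerC -(adjointP (L_bd i)).
rewrite -sumrN -big_split /=; apply: eq_bigr => i _.
by rewrite /dual /= innerDl innerNl addrC.
Qed.

Lemma block_metric_self_adjoint : self_adjoint block_metric.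
Proof.
have [_ _ _ P_sym _] := inverse_opP alpha_gt0 U_pos.
move=> k l; rewrite (innerC k) !block_metric_innerE P_sym (innerC (primal k)).
congr (_ - _ + _); first by apply: eq_bigr => i _; rewrite addrC.
apply: eq_bigr => i _.
have [_ _ _ Q_sym _] := inverse_opP alpha_gt0 (V_pos i).
by rewrite Q_sym innerC.
Qed.

Let diag (k : K) := '<inverse_op U (primal k), primal k>
  + \sum_i '<inverse_op (V i) (dual k i), dual k i>.

Lemma block_metric_formE (k : K) : '<block_metric k, k> =
  diag k - 2 * \sum_i '<L i (primal k), dual k i>.
Proof.
rewrite block_metric_innerE big_split /= /diag; ring.
Qed.

Let P_ge0 x : 0 <= '<inverse_op U x, x>.
Proof. by have [_ _ _ _ /(_ x)/andP[]] := inverse_opP alpha_gt0 U_pos. Qed.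

Let Q_ge0 i x : 0 <= '<inverse_op (V i) x, x>.
Proof. by have [_ _ _ _ /(_ x)/andP[]] := inverse_opP alpha_gt0 (V_pos i). Qed.

(** For the operators of step n, this is 1 / (1 + delta_n). *)
Definition coupling := Num.sqrt (\sum_(i < m)
  opnorm (sqrtop (V i) \o L i \o sqrtop U) ^+ 2).

(** The inequality of Cauchy-Schwarz for sums turns [coupling_le] into 2 sum_i
    <L_i x, v_i> <= 2 coupling a b <= coupling (a^2 + b^2), where a^2 and b^2
    are the primal and dual parts of [diag]. *)
Lemma block_metric_ge_diag (k : K) :
  (1 - coupling) * diag k <= '<block_metric k, k>.
Proof.
rewrite block_metric_formE.
suff : 2 * \sum_i '<L i (primal k), dual k i> <= coupling * diag k by lra.
set a := Num.sqrt '<inverse_op U (primal k), primal k>.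
pose b i := Num.sqrt '<inverse_op (V i) (dual k i), dual k i>.
pose s i := opnorm (sqrtop (V i) \o L i \o sqrtop U).
have h1 : \sum_i '<L i (primal k), dual k i> <= a * \sum_i s i * b i.
  rewrite mulr_sumr; apply: ler_sum => i _.
  by rewrite (le_trans (coupling_le _ _ alpha_gt0 (L_bd i) U_pos (V_pos i)))// -/(s i)
    -/a -/(b i) mulrCA.
have h2 := sum_cauchy_schwarz s b.
have a_ge0 : 0 <= a by exact: sqrtr_ge0.
have aE : '<inverse_op U (primal k), primal k> = a ^+ 2 by rewrite sqr_sqrtr.
have bE : \sum_i '<inverse_op (V i) (dual k i), dual k i> = \sum_i b i ^+ 2.
  by apply: eq_bigr => i _; rewrite sqr_sqrtr.
rewrite /diag aE bE -/(coupling).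
set t := \sum_i b i ^+ 2 in h2 *; set c := coupling.
have t_ge0 : 0 <= t by apply: sumr_ge0 => i _; exact: sqr_ge0.
have tE : t = Num.sqrt t ^+ 2 by rewrite sqr_sqrtr.
rewrite -/c in h2; have c_ge0 : 0 <= c by exact: sqrtr_ge0.
have h3 : a * \sum_i s i * b i <= a * (c * Num.sqrt t) by rewrite ler_wpM2l.
have h4 : 0 <= c * (a - Num.sqrt t) ^+ 2 by rewrite mulr_ge0 ?sqr_ge0.
rewrite tE; lra.
Qed.

Lemma block_metric_ge (mx : R) (k : K) : coupling <= 1 -> 0 < mx ->
  opnorm U <= mx -> (forall i, opnorm (V i) <= mx) ->
  (1 - coupling) / mx * `|k| ^+ 2 <= '<block_metric k, k>.
Proof.
move=> c1 mx_gt0 U_mx V_mx; apply: le_trans (block_metric_ge_diag k).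
rewrite -mulrA ler_wpM2l ?subr_ge0// ler_pdivrMl// sqrnorm_block /diag mulrDr.
rewrite lerD//.
  by apply: (le_trans (norm_le_inverse_form _ alpha_gt0 U_pos)); rewrite ler_wpM2r.
rewrite mulr_sumr; apply: ler_sum => i _.
by apply: (le_trans (norm_le_inverse_form _ alpha_gt0 (V_pos i))); rewrite ler_wpM2r.
Qed.

(** Changing the sign of the dual part changes the sign of the cross term only.
    So positivity of the form bounds the cross term by the diagonal terms. *)
Lemma block_metric_le (k : K) : coupling <= 1 ->
  '<block_metric k, k> <= 2 * alpha^-1 * `|k| ^+ 2.
Proof.
move=> c1; pose k' := mkblock (primal k) (fun i => - dual k i) : K.
have : 0 <= '<block_metric k', k'>.
  apply: le_trans (block_metric_ge_diag k'); rewrite mulr_ge0 ?subr_ge0//.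
  by rewrite addr_ge0// sumr_ge0.
have E1 : diag k' = diag k.
  congr (_ + _); apply: eq_bigr => i _; rewrite /dual /=.
  have [_ _ Q_lin _ _] := inverse_opP alpha_gt0 (V_pos i).
  by rewrite (linN Q_lin) innerNl innerNr opprK.
have E2 : \sum_i '<L i (primal k'), dual k' i> = - \sum_i '<L i (primal k), dual k i>.
  by rewrite -sumrN; apply: eq_bigr => i _; rewrite /dual /= innerNr.
have : diag k <= alpha^-1 * `|k| ^+ 2.
  rewrite sqrnorm_block mulrDr mulr_sumr lerD//.
    by have [_ _ _ _ /(_ (primal k))/andP[]] := inverse_opP alpha_gt0 U_pos.
  apply: ler_sum => i _.
  by have [_ _ _ _ /(_ (dual k i))/andP[]] := inverse_opP alpha_gt0 (V_pos i).
rewrite !block_metric_formE E1 E2; lra.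
Qed.

End BlockMetric.

(** * Resolvents and inverses of strongly monotone operators *)

Section Resolvents.
Variables (R : realType) (H : hilbertType R).

Lemma resolventP (A : H -> set H) (U : H -> H) (alpha : R) w :
  maximally_monotone A -> 0 < alpha -> posop alpha U ->
  let p := fun_of (resolvent (opcomp U A)) w in
  exists2 u, A p u & p + U u = w.
Proof.
move=> A_max alpha_gt0 U_pos p.
have : resolvent (opcomp U A) w p.
  apply: xgetPex.
  have [x [u [Axu xu]]] := resolvent_exists w A_max alpha_gt0 U_pos.
  by exists x; exists x => //; exists (U u) => //; exists u.
by move=> [s /= -> [_ [u Apu <-] pu]]; exists u.
Qed.

Section StronglyMonotone.
Variables (D : H -> set H) (nu : R).
Hypotheses (nu_gt0 : 0 < nu) (D_max : maximally_monotone D)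
  (D_strong : strongly_monotone nu D).

Lemma strongly_monotone_le x u y v : D x u -> D y v ->
  nu * `|x - y| ^+ 2 <= '<x - y, u - v>.
Proof.
move=> Dxu Dyv.
have : 0 <= '<x - y, (u - nu *: x) - (v - nu *: y)>.
  apply: D_strong.
    by exists u => //; exists (- (nu *: x)).
  by exists v => //; exists (- (nu *: y)).
have -> : u - nu *: x - (v - nu *: y) = (u - v) - nu *: (x - y).
  by apply: inner_ext => z; rewrite !innerE; ring.
by rewrite innerDr innerNr innerZr inner_norm subr_ge0.
Qed.

(** Minty's theorem for D - nu Id, which is maximally monotone, with constant
    1 / nu. *)
Lemma opinvP v : D (fun_of (opinv D) v) v.
Proof.
have [D_mon D_crit] := (iffLR (maximally_monotoneP D)) D_max.
apply: (@xgetPex _ 0 (opinv D v)).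
have D'_max : maximally_monotone (opadd D (single (fun x => - (nu *: x)))).
  apply/maximally_monotoneP; split; first exact: D_strong.
  move=> x u xu_rel; exists (u + nu *: x); last first.
    by exists (- (nu *: x)) => //; rewrite addrK.
  apply: D_crit => y w Dyw.
  have /= := xu_rel y (w - nu *: y) _.
  rewrite (_ : u - _ = (u + nu *: x - w) - nu *: (x - y)); last first.
    by apply: inner_ext => z; rewrite !innerE; ring.
  rewrite innerDr innerNr innerZr inner_norm subr_ge0 => h.
  apply: (@le_trans _ _ (nu * `|x - y| ^+ 2)); last first.
    by apply: h; exists w => //; exists (- (nu *: y)).
  by rewrite mulr_ge0 ?sqr_ge0// ltW.
have nui : 0 < nu^-1 by rewrite invr_gt0.
have [x [_ [[u Dxu [_ /= -> <-]] e]]] := minty (nu^-1 *: v) D'_max nui.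
exists x; rewrite /opinv /= (_ : v = u)//.
have := congr1 ( *:%R nu) e; rewrite scalerDr !scalerA mulfV ?gt_eqF// !scale1r.
by move=> <-; rewrite addrC subrK.
Qed.

Lemma opinv_cocoercive : cocoercive nu (fun_of (opinv D)).
Proof.
move=> v w; have h := strongly_monotone_le (opinvP v) (opinvP w).
by rewrite innerC.
Qed.

Lemma opinv_uniq x v : D x v -> x = fun_of (opinv D) v.
Proof.
move=> Dxv; have := strongly_monotone_le Dxv (opinvP v).
rewrite subrr inner0r pmulr_rle0// -inner_norm => h.
exact/subr0_eq/inner_le0.
Qed.

End StronglyMonotone.

End Resolvents.

(** Error terms inside a resolvent are propagated with a constant depending only
    on the bounds alpha and chi of the metrics. *)
Lemma resolvent_error (R : realType) (H : hilbertType R) (A : H -> set H) (U : H -> H)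
    (alpha chi : R) w w' :
  maximally_monotone A -> 0 < alpha -> posop alpha U -> opnorm U <= chi ->
  `|fun_of (resolvent (opcomp U A)) (w + U w') -
    fun_of (resolvent (opcomp U A)) w| <=
  (1 + alpha^-1 * chi) * (chi * `|w'|).
Proof.
move=> A_max alpha_gt0 U_pos U_chi; have [U_bd _ _] := U_pos.
have U_le x : `|U x| <= chi * `|x|.
  by rewrite (le_trans (opnorm_ge x U_bd))// ler_wpM2r.
have chi_ge0 : 0 <= chi by rewrite (le_trans _ U_chi)// opnorm_ge0.
have [u Au e] := resolventP (w + U w') A_max alpha_gt0 U_pos.
have [u' Au' e'] := resolventP w A_max alpha_gt0 U_pos.
apply: (le_trans (resolvent_lipschitz A_max.1 alpha_gt0 U_pos chi_ge0 U_le Au Au')).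
rewrite e e' addrAC subrr add0r ler_wpM2l// addr_ge0// mulr_ge0// invr_ge0 ltW//.
Qed.

(** * The primal-dual inclusion as a zero problem *)

Lemma big_setaddP (R : realType) (m : nat) (H : hilbertType R)
  (G : 'I_m -> hilbertType R) (f : forall i, G i -> H) (T : forall i, set (G i)) t :
  (\big[@setadd R H/[set 0]]_(i < m) (f i @` T i)) t <->
  exists2 v : forall i, G i, (forall i, T i (v i)) & t = \sum_(i < m) f i (v i).
Proof.
split; last first.
  move=> [v Tv ->]; elim/big_rec2: _ => // i S s _ Ss.
  by exists (f i (v i)); [exists (v i)|exists S].
have aux (r : seq 'I_m) t' : uniq r ->
    (\big[@setadd R H/[set 0]]_(i <- r) (f i @` T i)) t' ->
    exists2 s : 'I_m -> H, (forall i, i \in r -> (f i @` T i) (s i))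
      & t' = \sum_(i <- r) s i.
  elim: r t' => [|i r IH] t' /=.
    by move=> _; rewrite big_nil => ->; exists (fun=> 0); rewrite ?big_nil.
  move=> /andP[ir r_uniq]; rewrite big_cons => -[a Ta [b /(IH _ r_uniq)[s hs ->] <-]].
  exists (fun j => if j == i then a else s j) => [j|].
    by rewrite in_cons; case: eqP => [-> //|_ /=]; exact: hs.
  rewrite big_cons eqxx; congr (_ + _); rewrite !big_seq; apply: eq_bigr => j jr.
  by rewrite ifN//; apply: contraNneq ir => <-.
move=> /(aux _ _ (index_enum_uniq _)) [s hs ->].
have hs' i : (f i @` T i) (s i) by apply: hs; rewrite mem_index_enum.
pose v i : G i := xget 0 [set w | T i w /\ f i w = s i].
have vP i : T i (v i) /\ f i (v i) = s i.
  by apply: (@xgetPex _ 0 [set w | T i w /\ f i w = s i]); have [w Tw fw] := hs' i;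
    exists w.
by exists v => [i|]; [have [] := vP i|apply: eq_bigr => i _; have [_ ->] := vP i].
Qed.

Section BlockOperator.
Context {R : realType} {m : nat} {H : hilbertType R} {G : 'I_m -> hilbertType R}.
Variables (z : H) (A : H -> set H) (C : H -> H) (r : forall i, G i)
  (B D : forall i, G i -> set (G i)) (L : forall i, H -> G i).
Arguments B i _ : clear implicits.
Arguments D i _ : clear implicits.
Local Notation K := (block H G).

(** The operator k |-> (A x - z + sum_i adjoint L_i v_i, B_i^-1 v_i + r_i - L_i
    x), for k = (x, v), with its values described by membership in A and B_i. *)
Definition block_op (k : K) : set K := [set u |
  A (primal k) (primal u + z - \sum_i adjoint (L i) (dual k i)) /\
  forall i, B i (dual u i - r i + L i (primal k)) (dual k i)].

Definition block_coco (k : K) : K :=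
  mkblock (C (primal k)) (fun i => fun_of (opinv (D i)) (dual k i)).

Hypotheses (A_max : maximally_monotone A)
  (B_max : forall i, maximally_monotone (B i))
  (L_bd : forall i, bounded_linear (L i)).

(** Skewness of (x, v) |-> (sum_i adjoint L_i v_i, - L_i x) lets pairings with
    the graph be computed as if this map were absent ([pairing]). A pair (k, u)
    related to the whole graph is compared with the graph point (l, w) that
    Minty's theorem provides componentwise, with the same sum of point and
    value; the pairing is then - |k - l|^2, whence k = l. *)
Lemma block_op_maximally_monotone : maximally_monotone block_op.
Proof.
have skew (x x' : H) (v v' : forall i, G i) (a : H) (b : forall i, G i) :
    '<x - x', a> + \sum_i '<v i - v' i, b i> =
    '<x - x', a - \sum_i adjoint (L i) (v i - v' i)> +
    \sum_i '<v i - v' i, b i + L i (x - x')>.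
  rewrite innerDr innerNr (innerC _ (\sum_i _)) inner_suml -addrA; congr (_ + _).
  rewrite addrC -sumrB; apply: eq_bigr => i _.
  by rewrite innerDr (innerC (adjoint _ _)) -(adjointP (L_bd i)) (innerC (L i _)) addrK.
have pairing (k l u w : K) : '<k - l, u - w> =
    '<primal k - primal l, (primal u + z - \sum_i adjoint (L i) (dual k i))
       - (primal w + z - \sum_i adjoint (L i) (dual l i))>
    + \sum_i '<dual k i - dual l i, (dual u i - r i + L i (primal k))
       - (dual w i - r i + L i (primal l))>.
  rewrite block_innerE !primalB.
  transitivity ('<primal k - primal l, primal u - primal w>
      + \sum_i '<dual k i - dual l i, dual u i - dual w i>); first by [].
  rewrite skew; congr (_ + _).
    congr '<_, _>.
    have -> : \sum_i adjoint (L i) (dual k i - dual l i) =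
        \sum_i adjoint (L i) (dual k i) - \sum_i adjoint (L i) (dual l i).
      by rewrite -sumrB; apply: eq_bigr => i _; rewrite (linB (adjoint_linear (L_bd i))).
    by apply: inner_ext => y; rewrite !innerE; ring.
  apply: eq_bigr => i _; rewrite (linB (L_bd i).1).
  by congr '<_, _>; apply: inner_ext => y; rewrite !innerE; ring.
apply/maximally_monotoneP; split=> [k u l w [Au Bu] [Aw Bw]|k u ku_rel].
  rewrite pairing addr_ge0//; first by have [A_mon _] := A_max; exact: A_mon.
  apply: sumr_ge0 => i _; have [B_mon _] := B_max i.
  by rewrite innerC; exact: B_mon.
set s := primal u + z - \sum_i adjoint (L i) (dual k i).
pose t i := dual u i - r i + L i (primal k).
have [x [a [Axa xa]]] := minty (primal k + s) A_max ltr01.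
have vb_ex : forall i, exists vb : G i * G i,
   B i vb.2 vb.1 /\ vb.1 + 1 *: vb.2 = dual k i + t i.
  move=> i; have [v [b [Bvb vb]]] :=
    minty (dual k i + t i) (maximally_monotone_opinv (B_max i)) ltr01.
  by exists (v, b).
pose vb i := sval (cid (vb_ex i)).
have hvb i : B i (vb i).2 (vb i).1 /\ (vb i).1 + 1 *: (vb i).2 = dual k i + t i
  := svalP (cid (vb_ex i)).
pose l : K := mkblock x (fun i => (vb i).1).
pose w : K := mkblock (a - z + \sum_i adjoint (L i) (dual l i))
  (fun i => (vb i).2 + r i - L i x).
have w0 : primal w + z - \sum_i adjoint (L i) (dual l i) = a.
  rewrite (_ : primal w = a - z + \sum_i adjoint (L i) (dual l i))//.
  by apply: inner_ext => y; rewrite !innerE; ring.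
have wi i : dual w i - r i + L i (primal l) = (vb i).2.
  rewrite (_ : dual w i = (vb i).2 + r i - L i (primal l))//.
  by apply: inner_ext => y; rewrite !innerE; ring.
have lw : block_op l w.
  by split=> [|i]; [rewrite w0|rewrite wi; have [] := hvb i].
have e0 : s - a = - (primal k - primal l).
  apply: inner_ext => y; have := congr1 (fun t => '<t, y>) xa.
  by rewrite !innerE /= mul1r; lra.
have ei i : t i - (vb i).2 = - (dual k i - dual l i).
  apply: inner_ext => y; have [_ vbE] := hvb i.
  by have := congr1 (fun t => '<t, y>) vbE; rewrite !innerE /= mul1r; lra.
have kl : k = l.
  apply/subr0_eq/inner_le0; have := ku_rel _ _ lw; rewrite pairing -/s.
  rewrite w0 e0 innerNr (eq_bigr (fun i => - '<dual k i - dual l i, dual k i - dual l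
    i>)).
    by rewrite sumrN block_innerE -opprD oppr_ge0.
  by move=> i _; rewrite -/(t i) wi ei innerNr.
split=> [|i].
  have -> : primal u + z - \sum_i adjoint (L i) (dual k i) = a.
    by apply/subr0_eq; rewrite -/s e0 kl subrr oppr0.
  by rewrite kl.
have -> : dual u i - r i + L i (primal k) = (vb i).2.
  by apply/subr0_eq; rewrite -/(t i) ei kl subrr oppr0.
by rewrite kl; have [] := hvb i.
Qed.

Lemma block_coco_cocoercive (mu beta : R) (nu : 'I_m -> R) :
  cocoercive mu C -> (forall i, 0 < nu i) ->
  (forall i, maximally_monotone (D i)) ->
  (forall i, strongly_monotone (nu i) (D i)) ->
  beta <= mu -> (forall i, beta <= nu i) -> cocoercive beta block_coco.
Proof.
move=> C_coco nu_gt0 D_max D_strong beta_mu beta_nu k l.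
rewrite sqrnorm_block block_innerE mulrDr mulr_sumr lerD//.
  by apply: le_trans (C_coco _ _); rewrite ler_wpM2r ?sqr_ge0.
apply: ler_sum => i _.
apply: le_trans (opinv_cocoercive (nu_gt0 i) (D_max i) (D_strong i) _ _).
by rewrite ler_wpM2r ?sqr_ge0.
Qed.

Hypothesis opinv_D : forall i v, D i (fun_of (opinv (D i)) v) v.
Hypothesis opinv_D_uniq : forall i x v, D i x v -> x = fun_of (opinv (D i)) v.

Lemma block_zero_solution (k : K) : block_op k (- block_coco k) ->
  primal_solution z A C r B D L (primal k) /\
  dual_solution z A C r B D L (dual k).
Proof.
move=> [/= Ak Bk].
have A' : A (primal k) (z - \sum_i adjoint (L i) (dual k i) - C (primal k)).
  move: Ak; rewrite (_ : _ - _ = z - \sum_i adjoint (L i) (dual k i) - C (primal k))//.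
  by rewrite -addrA addrC.
have B' i : parallel_sum (B i) (D i) (L i (primal k) - r i) (dual k i).
  exists (dual (- block_coco k) i - r i + L i (primal k)); first exact: Bk.
  exists (fun_of (opinv (D i)) (dual k i)); first exact: opinv_D.
  rewrite (_ : dual (- _) i = - fun_of (opinv (D i)) (dual k i))//.
  by apply: inner_ext => y; rewrite !innerE; ring.
split.
  exists (z - C (primal k)); last first.
    by exists (C (primal k)) => //; rewrite subrK.
  exists (z - \sum_i adjoint (L i) (dual k i) - C (primal k)) => //.
  exists (\sum_i adjoint (L i) (dual k i)); last by rewrite addrAC subrK.
  by apply/big_setaddP; exists (dual k).
exists (primal k); split => //.
exists (z - \sum_i adjoint (L i) (dual k i) - C (primal k)) => //.
by exists (C (primal k)) => //; rewrite subrK.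
Qed.

Lemma block_zero_exists : ran (primal_op A C r B D L) z ->
  exists k : K, block_op k (- block_coco k).
Proof.
move=> [x [_ [a Aa [_ /big_setaddP[v Bv ->] <-]] [_ /= -> zE]]].
exists (mkblock x v); split=> [|i].
  rewrite (_ : _ - _ = a)//.
  rewrite (_ : primal (- _) = - C x)// (_ : \sum_i _ =
    \sum_(i < m) adjoint (L i) (v i))//.
  by rewrite -zE; apply: inner_ext => y; rewrite !innerE; ring.
have [b Bb [e De be]] := Bv i.
rewrite (_ : _ + _ = b)//.
rewrite (_ : dual (- _) i = - fun_of (opinv (D i)) (v i))//.
rewrite -(opinv_D_uniq De) (_ : primal _ = x)//.
move/eqP: be; rewrite eq_sym subr_eq => /eqP ->.
by apply: inner_ext => y; rewrite !innerE; ring.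
Qed.

End BlockOperator.

(** * One step of the algorithm *)

Section Iteration.
Context {R : realType} {m : nat} {H : hilbertType R} {G : 'I_m -> hilbertType R}.
Variables (z : H) (A : H -> set H) (C : H -> H) (r : forall i, G i)
  (B D : forall i, G i -> set (G i)) (L : forall i, H -> G i)
  (U : H -> H) (V : forall i, G i -> G i) (alpha : R).
Arguments B i _ : clear implicits.
Arguments D i _ : clear implicits.
Arguments V i _ : clear implicits.
Hypotheses (A_max : maximally_monotone A)
  (B_max : forall i, maximally_monotone (B i))
  (L_bd : forall i, bounded_linear (L i)) (alpha_gt0 : 0 < alpha)
  (U_pos : posop alpha U) (V_pos : forall i, posop alpha (V i)).
Local Notation K := (block H G).

Definition primal_step (k : K) : H :=
  fun_of (resolvent (opcomp U A))
    (primal k - U (\sum_(i < m) adjoint (L i) (dual k i) + C (primal k) - z)).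

Definition dual_step (k : K) i : G i :=
  fun_of (resolvent (opcomp (V i) (opinv (B i))))
    (dual k i + V i (L i (2 *: primal_step k - primal k)
                     - fun_of (opinv (D i)) (dual k i) - r i)).

(** The step without error terms; its dual part uses its own primal part. *)
Definition exact_step (k : K) : K := mkblock (primal_step k) (dual_step k).

Lemma exact_stepP (k : K) :
  block_op z A r B L (exact_step k)
    (block_metric L U V (k - exact_step k) - block_coco C D k).
Proof.
have [PU UP P_lin _ _] := inverse_opP alpha_gt0 U_pos.
set l := exact_step k; split=> [|i].
  have [u Au e] := resolventP (primal k - U (\sum_(i < m) adjoint (L i) (dual k i) + C
    (primal k) - z))
    A_max alpha_gt0 U_pos.
  rewrite -/(primal_step k) in Au e.
  rewrite (_ : _ - _ = u)//.
  have -> : primal (block_metric L U V (k - l) - block_coco C D k) =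
     inverse_op U (primal k - primal_step k) - \sum_i adjoint (L i) (dual k i - dual l
       i) - C (primal k) by [].
  have -> : primal k - primal_step k = U (u + (\sum_(i < m) adjoint (L i) (dual k i) +
    C (primal k) - z)).
    rewrite (linD (posop_linear U_pos)); apply: inner_ext => y; have :=
      congr1 (fun t => '<t, y>) e.
    by rewrite !innerE; lra.
  rewrite UP.
  have -> : \sum_i adjoint (L i) (dual k i - dual l i) =
      \sum_i adjoint (L i) (dual k i) - \sum_i adjoint (L i) (dual l i).
    by rewrite -sumrB; apply: eq_bigr => i _; rewrite (linB (adjoint_linear (L_bd i))).
  by apply: inner_ext => y; rewrite !innerE; ring.
have [QV VQ Q_lin _ _] := inverse_opP alpha_gt0 (V_pos i).
have [b Bb e] := resolventP (dual k i + V i (L i (2 *: primal_step k - primal k)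
                     - fun_of (opinv (D i)) (dual k i) - r i))
    (maximally_monotone_opinv (B_max i)) alpha_gt0 (V_pos i).
rewrite -/(dual_step k i) in Bb e.
rewrite (_ : _ + _ = b)//.
have -> : dual (block_metric L U V (k - l) - block_coco C D k) i =
   inverse_op (V i) (dual k i - dual_step k i) - L i (primal k - primal_step k)
     - fun_of (opinv (D i)) (dual k i) by [].
have -> : dual k i - dual_step k i = V i (b - (L i (2 *: primal_step k - primal k)
                     - fun_of (opinv (D i)) (dual k i) - r i)).
  rewrite (linB (posop_linear (V_pos i))); apply: inner_ext => y; have :=
    congr1 (fun t => '<t, y>) e.
  by rewrite !innerE; lra.
rewrite VQ (_ : primal l = primal_step k)//.
rewrite !(linB (L_bd i).1) (linZ (L_bd i).1).
by apply: inner_ext => y; rewrite !innerE; ring.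
Qed.

Lemma primal_step_error (chi : R) (k : K) c a : opnorm U <= chi ->
  `|fun_of (resolvent (opcomp U A))
      (primal k - U (\sum_(i < m) adjoint (L i) (dual k i) + C (primal k) + c - z))
    + a - primal_step k| <=
  (1 + alpha^-1 * chi) * chi * `|c| + `|a|.
Proof.
move=> U_chi; rewrite addrAC (le_trans (ler_normD _ _))// lerD2r.
rewrite (_ : primal k - U _ = (primal k - U (\sum_(i < m) adjoint (L i) (dual k i) + C
  (primal k) - z)) + U (- c)).
  by apply: (le_trans (resolvent_error _ _ A_max alpha_gt0 U_pos U_chi));
    rewrite normrN mulrA.
have U_lin := posop_linear U_pos.
rewrite !(linB U_lin, linD U_lin, linN U_lin).
by apply: inner_ext => y; rewrite !innerE; ring.
Qed.

(** The perturbed dual step is computed from a perturbed primal point p, which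
    enters the argument of the resolvent through 2 L_i p. *)
Lemma dual_step_error (chi : R) (k : K) (p : H) i (d b : G i) : opnorm (V i) <= chi ->
  `|fun_of (resolvent (opcomp (V i) (opinv (B i))))
      (dual k i + V i (L i (2 *: p - primal k)
        - fun_of (opinv (D i)) (dual k i) - d - r i)) + b - dual_step k i| <=
  (1 + alpha^-1 * chi) * chi * (2 * opnorm (L i) * `|p - primal_step k| + `|d|) + `|b|.
Proof.
move=> V_chi; rewrite addrAC (le_trans (ler_normD _ _))// lerD2r.
have chi_ge0 : 0 <= chi by rewrite (le_trans _ V_chi)// opnorm_ge0//; case: (V_pos i).
rewrite (_ : dual k i + V i _ = (dual k i + V i (L i (2 *: primal_step k - primal k)
        - fun_of (opinv (D i)) (dual k i) - r i))
   + V i (L i (2 *: (p - primal_step k)) - d)); last first.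
  rewrite -[RHS]addrA -(linD (posop_linear (V_pos i))); congr (_ + V i _).
  rewrite !(linB (L_bd i).1) !(linZ (L_bd i).1) (linB (L_bd i).1).
  by apply: inner_ext => y; rewrite !innerE; ring.
apply: (le_trans (resolvent_error _ _ (maximally_monotone_opinv (B_max i)) alpha_gt0
  (V_pos i) V_chi)).
have kap_ge0 : 0 <= (1 + alpha^-1 * chi) * chi.
  by rewrite mulr_ge0// addr_ge0// mulr_ge0// invr_ge0 ltW.
rewrite mulrA ler_wpM2l//.
rewrite (le_trans (ler_normB _ _))// lerD2r (le_trans (opnorm_ge _ (L_bd i)))//.
by rewrite normrZ ger0_norm// mulrCA mulrA.
Qed.

End Iteration.

(** * Convergence *)

(** Here s is the coupling 1 / (1 + delta), so that the last hypothesis is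
    zeta >= 1 / chi. It excludes s = 0 and mx = 0, for which the quotient is 0 because
    the inverse of 0 is 0. *)
Lemma step_size_bounds (R : realFieldType) (s mx chi : R) :
  0 <= s -> 0 <= mx -> 0 < chi ->
  chi^-1 <= (s^-1 - 1) / ((1 + (s^-1 - 1)) * mx) ->
  [/\ s <= 1, 0 < mx & chi^-1 <= (1 - s) / mx].
Proof.
move=> s_ge0 mx_ge0 chi_gt0.
have chii : 0 < chi^-1 by rewrite invr_gt0.
have [->|mx0] := eqVneq mx 0.
  by rewrite mulr0 invr0 mulr0 leNgt chii.
have [->|s0] := eqVneq s 0.
  by rewrite invr0 add0r subrr mul0r invr0 mulr0 leNgt chii.
rewrite (addrC 1) subrK.
rewrite (_ : _ / _ = (1 - s) / mx); last by field; rewrite s0 mx0.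
have mx_gt0 : 0 < mx by rewrite lt0r mx0.
move=> h; split => //; rewrite -subr_ge0.
by have := le_trans (ltW chii) h; rewrite pmulr_lge0// invr_gt0.
Qed.

Theorem corollary6p2 (R : realType) (m : nat) (m_gt0 : (0 < m)%N)
  (H : hilbertType R) (G : 'I_m -> hilbertType R)
  (z : H)
  (A : H -> set H) (A_max : maximally_monotone A)
  (mu : R) (mu_gt0 : 0 < mu)
  (C : H -> H) (C_coco : cocoercive mu C)
  (r : forall i, G i)
  (B : forall i, G i -> set (G i)) (B_max : forall i, maximally_monotone (B i))
  (nu : 'I_m -> R) (nu_gt0 : forall i, 0 < nu i)
  (D : forall i, G i -> set (G i)) (D_max : forall i, maximally_monotone (D i))
  (D_strong : forall i, strongly_monotone (nu i) (D i))
  (L : forall i, H -> G i) (L_bounded : forall i, bounded_linear (L i))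
  (L_neq0 : forall i, exists x, L i x != 0)
  (z_ran : ran (primal_op A C r B D L) z)
  (beta : R) (betaE : beta = \big[Num.min/mu]_(i < m) nu i)
  (eps : R) (eps_itv : 0 < eps < Num.min 1 beta)
  (alpha : R) (alpha_gt0 : 0 < alpha)
  (lambda : nat -> R) (lambda_itv : forall n, eps <= lambda n <= 1)
  (a c : nat -> H)
  (a_summable : absolutely_summable a) (c_summable : absolutely_summable c)
  (U : nat -> H -> H) (U_pos : forall n, posop alpha (U n))
  (U_incr : forall n, loewner_ge (U n.+1) (U n))
  (b d : forall i, nat -> G i)
  (b_summable : forall i, absolutely_summable (b i))
  (d_summable : forall i, absolutely_summable (d i))
  (V : forall i, nat -> G i -> G i)
  (V_pos : forall i n, posop alpha (V i n))
  (V_incr : forall i n, loewner_ge (V i n.+1) (V i n))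
  (delta : nat -> R)
  (deltaE : forall n, delta n =
     (Num.sqrt (\sum_(i < m)
        opnorm (sqrtop (V i n) \o L i \o sqrtop (U n)) ^+ 2))^-1 - 1)
  (zeta : nat -> R)
  (zetaE : forall n, zeta n =
     delta n / ((1 + delta n)
                * \big[Num.max/opnorm (U n)]_(i < m) opnorm (V i n)))
  (zeta_ge : forall n, zeta n >= 1 / (2 * beta - eps))
  (x0 : H) (v0 : forall i, G i)
  (x p y : nat -> H) (v q : forall i, nat -> G i)
  (x_init : x 0%N = x0) (v_init : forall i, v i 0%N = v0 i)
  (pE : forall n, p n =
     fun_of (resolvent (opcomp (U n) A))
       (x n - U n (\sum_(i < m) adjoint (L i) (v i n) + C (x n) + c n - z))
     + a n)
  (yE : forall n, y n = 2 *: p n - x n)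
  (xE : forall n, x n.+1 = x n + lambda n *: (p n - x n))
  (qE : forall i n, q i n =
     fun_of (resolvent (opcomp (V i n) (opinv (B i))))
       (v i n + V i n (L i (y n) - fun_of (opinv (D i)) (v i n)
                       - d i n - r i))
     + b i n)
  (vE : forall i n, v i n.+1 = v i n + lambda n *: (q i n - v i n)) :
  exists (xbar : H) (vbar : forall i, G i),
    [/\ primal_solution z A C r B D L xbar /\
        dual_solution z A C r B D L vbar,
        weak_cvg x xbar,
        forall i, weak_cvg (v i) (vbar i),
        demiregular (single C) xbar -> x @ \oo --> xbar
      & forall j, demiregular (opinv (D j)) (vbar j) ->
          v j @ \oo --> vbar j].
Proof.
have /andP[eps_gt0 eps_lt] := eps_itv.
have [eps1 eps_beta] : eps < 1 /\ eps < beta.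
  by move: eps_lt; rewrite lt_min => /andP[].
have beta_gt0 : 0 < beta by exact: lt_trans eps_beta.
have beta_mu : beta <= mu by rewrite betaE bigmin_le_id.
have beta_nu i : beta <= nu i by rewrite betaE; exact: bigmin_le.
(* [chi] bounds the norms of all U n and V i n, because zeta n <= 1 / mx n. *)
pose chi := 2 * beta - eps.
have chi_gt0 : 0 < chi by rewrite /chi; lra.
pose cpl n := coupling L (U n) (fun i => V i n).
pose mx n := \big[Num.max/opnorm (U n)]_(i < m) opnorm (V i n).
have U_mx n : opnorm (U n) <= mx n by exact: bigmax_ge_id.
have V_mx i n : opnorm (V i n) <= mx n by exact: le_bigmax.
have [cpl_le1 mx_gt0 zeta_cpl] : [/\ forall n, cpl n <= 1, forall n, 0 < mx n
    & forall n, chi^-1 <= (1 - cpl n) / mx n].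
  have all n : [/\ cpl n <= 1, 0 < mx n & chi^-1 <= (1 - cpl n) / mx n].
    have dE : delta n = (cpl n)^-1 - 1 by exact: deltaE.
    have := zeta_ge n; rewrite zetaE dE -/(mx n) -/chi mul1r.
    apply: step_size_bounds => //; first exact: sqrtr_ge0.
    by rewrite (le_trans _ (U_mx n))// opnorm_ge0//; case: (U_pos n).
  by split=> n; have [] := all n.
have mx_chi n : mx n <= chi.
  rewrite -lef_pV2 ?posrE//; apply: (le_trans (zeta_cpl n)).
  rewrite ler_piMl ?invr_ge0 ?(ltW (mx_gt0 n))// gerBl.
  exact: sqrtr_ge0.
have U_chi n : opnorm (U n) <= chi by exact: le_trans (mx_chi n).
have V_chi i n : opnorm (V i n) <= chi by exact: le_trans (mx_chi n).
(* [kh n] is the exact step from [k n]; [e n] gathers all errors. *)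
pose W n := block_metric L (U n) (fun i => V i n).
pose k n : block H G := mkblock (x n) (fun i => v i n).
pose kh n := exact_step z A C r B D L (U n) (fun i => V i n) (k n).
pose e n : block H G := lambda n *: (mkblock (p n) (fun i => q i n) - kh n).
have kS n : k n.+1 = k n + lambda n *: (kh n - k n) + e n.
  apply: block_ext => [|i].
    rewrite primalD primalD primalZ primalZ !primalB.
    rewrite /primal /= xE -/(primal (kh n)).
    by apply: inner_ext => w; rewrite !innerE; ring.
  rewrite dualD dualD dualZ dualZ !dualB.
  rewrite /dual /= vE -/(dual (kh n) i).
  by apply: inner_ext => w; rewrite !innerE; ring.
pose kap := (1 + alpha^-1 * chi) * chi.
have kap_ge0 : 0 <= kap.
  rewrite mulr_ge0 ?(ltW chi_gt0)// addr_ge0// mulr_ge0 ?(ltW chi_gt0)//.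
  by rewrite invr_ge0 ltW.
(* The dual error of step n also contains the primal error of step n, through y
   n. *)
pose ep n := kap * `|c n| + `|a n|.
pose eq i n := kap * (2 * opnorm (L i) * ep n + `|d i n|) + `|b i n|.
have p_err n : `|p n - primal (kh n)| <= ep n.
  rewrite pE; exact: (@primal_step_error R m H G z A C L (U n) alpha A_max
    alpha_gt0 (U_pos n) chi (k n) (c n) (a n) (U_chi n)).
have q_err i n : `|q i n - dual (kh n) i| <= eq i n.
  rewrite qE yE.
  apply: (le_trans (@dual_step_error R m H G z A C r B D L (U n) (fun i => V i n)
    alpha B_max L_bounded alpha_gt0 (fun i => V_pos i n) chi (k n) (p n) i (d i n)
    (b i n) (V_chi i n))).
  rewrite lerD2r ler_wpM2l// lerD2r ler_wpM2l ?p_err//.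
  by rewrite mulr_ge0// opnorm_ge0.
have ep_sum : summable_seq ep.
  apply: summable_seqD; last exact: absolutely_summableP.
  by apply: summable_seqZ => //; exact: absolutely_summableP.
have eq_sum i : summable_seq (eq i).
  apply: summable_seqD; last exact: absolutely_summableP.
  apply: summable_seqZ => //; apply: summable_seqD; last exact: absolutely_summableP.
  by apply: summable_seqZ => //; rewrite mulr_ge0// opnorm_ge0.
have e_sum : summable_seq (fun n => `|e n|).
  apply: (@le_summable_seq _ _ (fun n => ep n + \sum_i eq i n)); last first.
    by apply: summable_seqD => //; exact: summable_seq_sum.
  move=> n; have /andP[l1 l2] := lambda_itv n.
  rewrite normrZ ger0_norm; last by rewrite (le_trans _ l1)// ltW.
  apply: (le_trans (ler_piMl _ l2)) => //.
  apply: (le_trans (norm_block_le _)); rewrite lerD//; first exact: p_err.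
  by apply: ler_sum => i _; exact: q_err.
have [kb [kb_sol kb_weak kb_strong]] : exists kb, [/\
    block_op z A r B L kb (- block_coco C D kb), weak_cvg k kb
    & (fun n => block_coco C D (k n)) @ \oo --> block_coco C D kb].
  apply: (@forward_backward_weak_cvg R (block H G) (block_op z A r B L)
    (block_coco C D) beta _ _ _ W chi^-1 (2 * alpha^-1) _ _ _ _ _ _ _ _
    lambda eps _ _ k kh e) => //.
  - exact: block_op_maximally_monotone.
  - exact: (block_coco_cocoercive C_coco nu_gt0 D_max D_strong beta_mu beta_nu).
  - by move=> n; apply: (block_metric_linear alpha_gt0 L_bounded (U_pos n)) => i;
    exact: V_pos.
  - by move=> n; apply: (block_metric_self_adjoint alpha_gt0 L_bounded (U_pos n)) => i;
    exact: V_pos.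
  - move=> n w; apply: (@le_trans _ _ ((1 - cpl n) / mx n * `|w| ^+ 2)).
      by rewrite ler_wpM2r ?sqr_ge0.
    exact: (@block_metric_ge R m H G L (U n) (fun i => V i n) alpha alpha_gt0
      L_bounded (U_pos n) (fun i => V_pos i n) (mx n) w (cpl_le1 n) (mx_gt0 n)
      (U_mx n) (fun i => V_mx i n)).
  - move=> n w; exact: (@block_metric_le R m H G L (U n) (fun i => V i n) alpha
      alpha_gt0 L_bounded (U_pos n) (fun i => V_pos i n) w (cpl_le1 n)).
  - move=> n w.
    rewrite !(block_metric_innerE _ _ L_bounded) !lerD//.
      exact: (inverse_op_antitone alpha_gt0).
    by apply: ler_sum => i _; exact: (inverse_op_antitone alpha_gt0).
  - by rewrite invr_gt0.
  - by rewrite ltr_pdivlMr// mul1r /chi; lra.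
  - by rewrite mulr_ge0// invr_ge0 ltW.
  - move=> n; exact: (@exact_stepP R m H G z A C r B D L (U n) (fun i => V i n)
      alpha A_max B_max L_bounded alpha_gt0 (U_pos n) (fun i => V_pos i n)).
  - apply: block_zero_exists z_ran.
    by move=> i x' v'; exact: opinv_uniq.
have [P_sol D_sol] := block_zero_solution (fun i =>
  opinvP (nu_gt0 i) (D_max i) (D_strong i)) kb_sol.
have x_weak : weak_cvg x (primal kb) by exact: weak_cvg_primal kb_weak.
have v_weak i : weak_cvg (v i) (dual kb i) by exact: (@weak_cvg_dual R m H G i k kb
  kb_weak).
exists (primal kb), (dual kb); split => //.
- move=> [_ C_demi]; apply: (C_demi x (fun n => C (x n)) (C (primal kb))) => //.
  apply/cvgrPdist_lt => eta eta_gt0.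
  have /cvgrPdist_lt /(_ eta eta_gt0) := kb_strong.
  by apply: filterS => n; apply: le_lt_trans; exact: (primal_norm_le (_ - _)).
- move=> j [_ D_demi].
  apply: (D_demi (v j) (fun n => fun_of (opinv (D j)) (v j n)) (fun_of (opinv (D j))
    (dual kb j))) => //.
  + by move=> n; exact: opinvP (nu_gt0 j) (D_max j) (D_strong j) _.
  + exact: opinvP (nu_gt0 j) (D_max j) (D_strong j) _.
  apply/cvgrPdist_lt => eta eta_gt0.
  have /cvgrPdist_lt /(_ eta eta_gt0) := kb_strong.
  by apply: filterS => n; apply: le_lt_trans; exact: (dual_norm_le (_ - _) j).
Qed.
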